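(* Let $\Bbbk$ be a field, let $n\ge 1$, and let $q_{ij}\in\Bbbk$ ($1\le i<j\le n$) be nonzero scalars. Let $A$ be the associative unital $\Bbbk$-algebra generated by $x_1,\dots,x_n$ subject to the relations $x_jx_i=q_{ij}x_ix_j$ for $i<j$. Let $B$ be the associative unital $\Bbbk$-algebra generated by elements $z_i^j$ ($1\le i,j\le n$) subject to the relations $$z^\ell_j z^\ell_i = q_{ij}\, z^\ell_i z^\ell_j\qquad\text{for all }\ell\text{ and all } i<j,$$ $$q_{ij}\, z^k_i z^\ell_j - q_{k\ell}\, z^\ell_j z^k_i = z^k_j z^\ell_i - q_{k\ell}q_{ij}\, z^\ell_i z^k_j\qquad\text{for all } i<j \text{ and } k<\ell,$$ and let $Z=(z_i^j)_{n\times n}$. In the algebra $B\otimes_{\Bbbk} A=\bigoplus_{\mathbf m} B\otimes x^{\mathbf m}$, where $\mathbf m=(m_1,\dots,m_n)$ runs over $\mathbb Z_{\ge 0}^n$ and $x^{\mathbf m}:=x_1^{m_1}x_2^{m_2}\cdots x_n^{m_n}$, consider the elements $X_i=\sum_{j} z_i^j\otimes x_j$ ($1\le i\le n$). Let $G(\mathbf m)\in B$ be the $B$-coefficient of $x^{\mathbf m}$ in $X^{\mathbf m}=X_1^{m_1}X_2^{m_2}\cdots X_n^{m_n}$, and define power series in $B[[t]]$ by $$\mathrm{Bos}(Z):=\sum_{\ell\ge 0}\ \sum_{\mathbf m:\ |\mathbf m|=\ell} G(\mathbf m)\,t^\ell,\qquad \mathrm{Ferm}(Z):=\sum_{m\ge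 0}\ \sum_{\substack{J\subseteq\{1,\dots,n\}\\ |J|=m}}(-1)^m\,{\det}_{\mathbf q}(Z_J)\,t^m ,$$ where $|\mathbf m|=m_1+\dots+m_n$ and, for $J=\{j_1<j_2<\dots<j_m\}$, $${\det}_{\mathbf q}(Z_J)=\sum_{\pi\in\mathfrak S_m} w_J(\pi)\, z^{j_1}_{j_{\pi 1}}z^{j_2}_{j_{\pi 2}}\cdots z^{j_m}_{j_{\pi m}},\qquad w_J(\pi)=\prod_{\substack{1\le a<b\le m\\ \pi a>\pi b}}\bigl(-q_{j_{\pi b},\,j_{\pi a}}\bigr)^{-1}.$$ Then in $B[[t]]$ $$\mathrm{Bos}(Z)\cdot\mathrm{Ferm}(Z)=1 .$$
   Context: $B[[t]]$ is the ring of formal power series in a central variable $t$ over the (noncommutative) ring $B$. The tensor product algebra $B\otimes_{\Bbbk}A$ has multiplication $(b\otimes a)(b'\otimes a')=bb'\otimes aa'$. The monomials $x^{\mathbf m}$, $\mathbf m\in\mathbb Z_{\ge0}^n$, form a $\Bbbk$-basis of $A$, so every element of $B\otimes A$ is uniquely a finite sum $\sum_{\mathbf m} b_{\mathbf m}\otimes x^{\mathbf m}$ with $b_{\mathbf m}\in B$, and $b_{\mathbf m}$ is called its $B$-coefficient of $x^{\mathbf m}$. $\mathfrak S_m$ is the symmetric group on $\{1,\dots,m\}$; for $J=\emptyset$ one has ${\det}_{\mathbf q}(Z_J)=1$. In $z_i^j$ the lower index $i$ and the upper index $j$ are both indices (not exponents). *)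

(* Defs.v *)
From HB Require Import structures.
From mathcomp Require Import all_boot all_order all_algebra all_fingroup.
From mathcomp Require Import generic_quotient ring_quotient.
From mathcomp Require Import finmap boolp classical_sets.
From mathcomp.multinomials Require Import monalg.

Set Implicit Arguments.
Unset Strict Implicit.
Unset Printing Implicit Defensive.

Import GRing.Theory.
Local Open Scope ring_scope.
Local Open Scope quotient_scope.

(* The free associative unital k-algebra on G is the algebra of the free
   monoid on G. *)
Notation free_alg k G := {malg k[{fmonom G}]}.

Section Presented.
Variables (k : fieldType) (G : choiceType).
Local Notation F := (free_alg k G).

Definition free_gen (g : G) : F := << fmu g >>.

Variable rel : F -> F -> Prop.

(* The two-sided ideal generated by the differences u - v with rel u v. *)
Inductive rel_ideal : F -> Prop :=
| rel_ideal_base u v of rel u v : rel_ideal (u - v)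
| rel_ideal0 : rel_ideal 0
| rel_idealD u v of rel_ideal u & rel_ideal v : rel_ideal (u + v)
| rel_idealMl w u of rel_ideal u : rel_ideal (w * u)
| rel_idealMr w u of rel_ideal u : rel_ideal (u * w).

Definition rel_ideal_pred : {pred F} := fun u => `[< rel_ideal u >].

Lemma rel_ideal_zmod_closed : zmod_closed rel_ideal_pred.
Proof.
split=> [|u v /asboolP Iu /asboolP Iv]; apply/asboolP; first exact: rel_ideal0.
by rewrite -mulN1r; apply: rel_idealD => //; apply: rel_idealMl.
Qed.

HB.instance Definition _ :=
  GRing.isZmodClosed.Build F rel_ideal_pred rel_ideal_zmod_closed.

Definition presented : Type := Quotient.quot rel_ideal_pred.

HB.instance Definition _ := GRing.Zmodule.on presented.
HB.instance Definition _ := EqQuotient.on presented.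

Definition pres_pi : F -> presented := \pi_presented.

Lemma pres_piP u v : pres_pi u = pres_pi v <-> rel_ideal (u - v).
Proof.
split=> [/eqP|I].
  by rewrite -Quotient.idealrBE => /asboolP.
by apply/eqP; rewrite -Quotient.idealrBE; apply/asboolP.
Qed.

Lemma pres_piK (x : presented) : pres_pi (repr x) = x.
Proof. exact: reprK. Qed.

Lemma pres_repr u : rel_ideal (repr (pres_pi u) - u).
Proof. by apply/pres_piP; rewrite pres_piK. Qed.

Lemma pres_piB : zmod_morphism pres_pi.
Proof. by move=> u v; rewrite /pres_pi !piE. Qed.

HB.instance Definition _ := GRing.isZmodMorphism.Build F presented pres_pi pres_piB.

Definition pres_one : presented := pres_pi 1.
Definition pres_mul (x y : presented) :=
  locked (pres_pi (repr x * repr y)).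
Definition pres_scale (c : k) (x : presented) :=
  locked (pres_pi (c *: repr x)).

Lemma pres_mul_pi u v : pres_pi (u * v) = pres_mul (pres_pi u) (pres_pi v).
Proof.
rewrite /pres_mul -lock.
apply/esym/pres_piP.
have -> : repr (pres_pi u) * repr (pres_pi v) - u * v =
  (repr (pres_pi u) - u) * repr (pres_pi v) + u * (repr (pres_pi v) - v).
  by rewrite mulrBl mulrBr addrA subrK.
by apply: rel_idealD; [apply: rel_idealMr|apply: rel_idealMl]; apply: pres_repr.
Qed.

Lemma pres_scale_pi c u : pres_pi (c *: u) = pres_scale c (pres_pi u).
Proof.
rewrite /pres_scale -lock.
apply/esym/pres_piP; rewrite -scalerBr -mul_malgC.
by apply: rel_idealMl; apply: pres_repr.
Qed.

Lemma pres_mulA : associative pres_mul.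
Proof.
move=> x y z; rewrite -[x]pres_piK -[y]pres_piK -[z]pres_piK.
by rewrite -!pres_mul_pi mulrA.
Qed.

Lemma pres_mul1 : left_id pres_one pres_mul.
Proof. by move=> x; rewrite -[x]pres_piK -pres_mul_pi mul1r. Qed.

Lemma pres_mulr1 : right_id pres_one pres_mul.
Proof. by move=> x; rewrite -[x]pres_piK -pres_mul_pi mulr1. Qed.

Lemma pres_mulDl : left_distributive pres_mul +%R.
Proof.
move=> x y z; rewrite -[x]pres_piK -[y]pres_piK -[z]pres_piK.
by rewrite -!pres_mul_pi -!raddfD /= -pres_mul_pi mulrDl.
Qed.

Lemma pres_mulDr : right_distributive pres_mul +%R.
Proof.
move=> x y z; rewrite -[x]pres_piK -[y]pres_piK -[z]pres_piK.
by rewrite -!pres_mul_pi -!raddfD /= -pres_mul_pi mulrDr.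
Qed.

HB.instance Definition _ := GRing.Zmodule_isPzRing.Build presented
  pres_mulA pres_mul1 pres_mulr1 pres_mulDl pres_mulDr.

Lemma pres_scaleA a b x : pres_scale a (pres_scale b x) = pres_scale (a * b) x.
Proof. by rewrite -[x]pres_piK -!pres_scale_pi scalerA. Qed.

Lemma pres_scale1 : left_id 1 pres_scale.
Proof. by move=> x; rewrite -[x]pres_piK -pres_scale_pi scale1r. Qed.

Lemma pres_scaleDr : right_distributive pres_scale +%R.
Proof.
move=> c x y; rewrite -[x]pres_piK -[y]pres_piK.
by rewrite -!pres_scale_pi -!raddfD /= -pres_scale_pi scalerDr.
Qed.

Lemma pres_scaleDl x : {morph pres_scale^~ x : a b / a + b}.
Proof.
by move=> a b; rewrite -[x]pres_piK -!pres_scale_pi scalerDl raddfD.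
Qed.

HB.instance Definition _ := GRing.Zmodule_isLmodule.Build k presented
  pres_scaleA pres_scale1 pres_scaleDr pres_scaleDl.

Lemma free_scalerAr (c : k) (u v : F) : c *: (u * v) = u * (c *: v).
Proof.
have le := msuppZ_le c v.
apply/malgP=> w; rewrite mcoeffZ [in LHS]mcoeffMl big_distrr /=.
rewrite [RHS](mcoeffMlw w (fsubset_refl (msupp u)) le).
apply: eq_bigr => w1 _; rewrite big_distrr /=; apply: eq_bigr => w2 _.
rewrite mcoeffZ.
by rewrite mulrnAr mulrCA.
Qed.

Lemma pres_piZ c u : pres_pi (c *: u) = c *: pres_pi u.
Proof. exact: pres_scale_pi. Qed.

Lemma pres_piM u v : pres_pi (u * v) = pres_pi u * pres_pi v.
Proof. exact: pres_mul_pi. Qed.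

Lemma pres_scalerAl (c : k) (x y : presented) : c *: (x * y) = (c *: x) * y.
Proof.
by rewrite -[x]pres_piK -[y]pres_piK -pres_piZ -!pres_piM -pres_piZ scalerAl.
Qed.

Lemma pres_scalerAr (c : k) (x y : presented) : c *: (x * y) = x * (c *: y).
Proof.
by rewrite -[x]pres_piK -[y]pres_piK -pres_piZ -!pres_piM -pres_piZ free_scalerAr.
Qed.

Lemma free_wordM (v w : {fmonom G}) : (<< v >> * << w >> : F) = << fmmul v w >>.
Proof. by rewrite malgM_def fgmulUU mulr1. Qed.

Lemma free_wordZ (c : k) (w : {fmonom G}) : << c *g w >> = c *: (<< w >> : F).
Proof. by apply/malgP=> v; rewrite mcoeffZ 2!mcoeffU mulrnAr mulr1. Qed.

Lemma coef1M (u v : F) : (u * v)@_mone = u@_mone * v@_mone.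
Proof. exact: (rmorphM (mcoeff mone)). Qed.

Lemma coef1_genM g h : (free_gen g * free_gen h)@_mone = 0.
Proof. by rewrite coef1M {1}/free_gen mcoeffU fm1_eq1 mul0r. Qed.

Lemma coef1Z0 c (u : F) : u@_mone = 0 -> (c *: u)@_mone = 0.
Proof. by rewrite mcoeffZ => ->; rewrite mulr0. Qed.

Lemma coef1B0 (u v : F) : u@_mone = 0 -> v@_mone = 0 -> (u - v)@_mone = 0.
Proof. by rewrite mcoeffB => -> ->; rewrite subr0. Qed.

Lemma pres_oner_neq0 :
  (forall u v, rel u v -> (u - v)@_mone = 0) -> (1 : presented) != 0.
Proof.
move=> rel1; apply/eqP => pi1_0.
have /pres_piP : pres_pi 1 = pres_pi 0 by rewrite raddf0.
suff H u : rel_ideal u -> u@_mone = 0.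
  by rewrite subr0 => /H/eqP; rewrite (rmorph1 (mcoeff mone)) oner_eq0.
elim=> [{}u v /rel1 uv||{}u v _ u0 _ v0|w {}u _ u0|w {}u _ u0].
- exact: uv.
- exact: raddf0.
- by rewrite raddfD /= u0 v0 addr0.
- by rewrite coef1M u0 mulr0.
- by rewrite coef1M u0 mul0r.
Qed.

Definition pres_gen (g : G) : presented := pres_pi (free_gen g).

End Presented.

Section QuantumSpace.
Variables (k : fieldType) (n : nat) (q : 'I_n -> 'I_n -> k).

Inductive qspace_rel : free_alg k 'I_n -> free_alg k 'I_n -> Prop :=
| Qspace_rel (i j : 'I_n) of (i < j)%N :
    qspace_rel (free_gen k j * free_gen k i)
               (q i j *: (free_gen k i * free_gen k j)).

Definition qspace : Type := presented qspace_rel.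

HB.instance Definition _ := GRing.PzRing.on qspace.
HB.instance Definition _ := GRing.Lmodule.on qspace.

Lemma qspace_oner_neq0 : (1 : qspace) != 0.
Proof.
apply: pres_oner_neq0 => _ _ [i j _].
by apply: coef1B0; [|apply: coef1Z0]; apply: coef1_genM.
Qed.

HB.instance Definition _ :=
  GRing.PzSemiRing_isNonZero.Build qspace qspace_oner_neq0.
HB.instance Definition _ :=
  GRing.Lmodule_isLalgebra.Build k qspace (@pres_scalerAl k _ qspace_rel).
HB.instance Definition _ :=
  GRing.Lalgebra_isAlgebra.Build k qspace (@pres_scalerAr k _ qspace_rel).

Definition qx (i : 'I_n) : qspace := pres_gen qspace_rel i.

Definition qx_mon (m : {ffun 'I_n -> nat}) : qspace := \prod_(i < n) qx i ^+ m i.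

End QuantumSpace.

Section QuantumMatrices.
Variables (k : fieldType) (n : nat) (q : 'I_n -> 'I_n -> k).

(* The generator (i, j) is z_i^j: lower index first. *)
Local Notation z i j := (free_gen k (i, j)).

Inductive qmat_rel :
    free_alg k ('I_n * 'I_n)%type -> free_alg k ('I_n * 'I_n)%type -> Prop :=
| Qmat_rel_same (i j l : 'I_n) of (i < j)%N :
    qmat_rel (z j l * z i l) (q i j *: (z i l * z j l))
| Qmat_rel_cross (i j h l : 'I_n) of (i < j)%N & (h < l)%N :
    qmat_rel (q i j *: (z i h * z j l) - q h l *: (z j l * z i h))
             (z j h * z i l - (q h l * q i j) *: (z i l * z j h)).

Definition qmat : Type := presented qmat_rel.

HB.instance Definition _ := GRing.PzRing.on qmat.
HB.instance Definition _ := GRing.Lmodule.on qmat.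

Lemma qmat_oner_neq0 : (1 : qmat) != 0.
Proof.
apply: pres_oner_neq0 => _ _ [i j l _|i j h l _ _].
  by apply: coef1B0; [|apply: coef1Z0]; apply: coef1_genM.
apply: coef1B0; apply: coef1B0; do ?apply: coef1Z0; exact: coef1_genM.
Qed.

HB.instance Definition _ :=
  GRing.PzSemiRing_isNonZero.Build qmat qmat_oner_neq0.
HB.instance Definition _ :=
  GRing.Lmodule_isLalgebra.Build k qmat (@pres_scalerAl k _ qmat_rel).
HB.instance Definition _ :=
  GRing.Lalgebra_isAlgebra.Build k qmat (@pres_scalerAr k _ qmat_rel).

Definition qz (i j : 'I_n) : qmat := pres_gen qmat_rel (i, j).

End QuantumMatrices.

Section Tensor.
Variables (k : fieldType) (B A : algType k).

Local Notation F := (free_alg k (B * A)%type).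
Local Notation W := {fmonom (B * A)%type}.
Local Notation g b a := (free_gen k ((b, a) : B * A)).

(* B (x) A: symbols b (x) a subject to bilinearity and
   (b (x) a)(b' (x) a') = b b' (x) a a', with unit 1 (x) 1.  By [tensor_span] and [tensor_lift]
   below, its underlying vector space is the usual tensor product. *)
Inductive tensor_rel : F -> F -> Prop :=
| Tensor_relDl b b' a : tensor_rel (g (b + b') a) (g b a + g b' a)
| Tensor_relDr b a a' : tensor_rel (g b (a + a')) (g b a + g b a')
| Tensor_relZl c b a : tensor_rel (g (c *: b) a) (c *: g b a)
| Tensor_relZr c b a : tensor_rel (g b (c *: a)) (c *: g b a)
| Tensor_relM b b' a a' : tensor_rel (g b a * g b' a') (g (b * b') (a * a'))
| Tensor_rel1 : tensor_rel (g 1 1) 1.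

Definition tensor : Type := presented tensor_rel.

HB.instance Definition _ := GRing.PzRing.on tensor.
HB.instance Definition _ := GRing.Lmodule.on tensor.

Definition tens (b : B) (a : A) : tensor := pres_gen tensor_rel (b, a).

Let tens_rel u v : tensor_rel u v -> pres_pi tensor_rel u = pres_pi tensor_rel v.
Proof. by move=> uv; apply/pres_piP; apply: rel_ideal_base. Qed.

Lemma tensDl b b' a : tens (b + b') a = tens b a + tens b' a.
Proof. by rewrite /tens /pres_gen -raddfD; apply/tens_rel/Tensor_relDl. Qed.

Lemma tensDr b a a' : tens b (a + a') = tens b a + tens b a'.
Proof. by rewrite /tens /pres_gen -raddfD; apply/tens_rel/Tensor_relDr. Qed.

Lemma tensZl c b a : tens (c *: b) a = c *: tens b a.
Proof. by rewrite /tens /pres_gen -pres_piZ; apply/tens_rel/Tensor_relZl. Qed.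

Lemma tensZr c b a : tens b (c *: a) = c *: tens b a.
Proof. by rewrite /tens /pres_gen -pres_piZ; apply/tens_rel/Tensor_relZr. Qed.

Lemma tensM b b' a a' : tens b a * tens b' a' = tens (b * b') (a * a').
Proof. by rewrite /tens /pres_gen -pres_piM; apply/tens_rel/Tensor_relM. Qed.

Lemma tens1 : tens 1 1 = 1.
Proof. exact/tens_rel/Tensor_rel1. Qed.

Lemma tensor_span (x : tensor) :
  exists s : seq (B * A), x = \sum_(p <- s) tens p.1 p.2.
Proof.
rewrite -[x]pres_piK [repr x]monalgE raddf_sum.
elim: (enum_fset _) => [|w s [r IHs]]; first by exists [::]; rewrite !big_nil.
rewrite big_cons IHs; move: (_ @_ _) => c.
suff [p Hp] : exists p : B * A, pres_pi tensor_rel << c *g w >> = tens p.1 p.2.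
  by exists (p :: r); rewrite big_cons -Hp.
suff [p Hp] : exists p : B * A, pres_pi tensor_rel << w >> = tens p.1 p.2.
  by exists (c *: p.1, p.2); rewrite free_wordZ tensZl -Hp pres_piZ.
case: w => w; elim: w => [|h w [p IH]].
  by exists (1, 1); rewrite tens1 -fmoneE.
exists (h.1 * p.1, h.2 * p.2); rewrite -tensM -IH /tens /pres_gen -pres_piM.
congr pres_pi.
by rewrite free_wordM -surjective_pairing fmmulE fmuE.
Qed.

Section Lift.
Variables (V : lmodType k) (f : B -> A -> V).
Hypotheses (flinl : forall a, linear (f^~ a)) (flinr : forall b, linear (f b)).

Let h (w : W) : V :=
  f (\prod_(p <- w) p.1) (\prod_(p <- w) p.2).

Let ext (u : F) : V := \sum_(w <- msupp u) u@_w *: h w.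

Let extE (d : {fset W}) u : (msupp u `<=` d)%fset ->
  ext u = \sum_(w <- d) u@_w *: h w.
Proof.
move=> le; rewrite [LHS](big_fset_incl _ le) => //= w _ /mcoeff_outdom ->.
by rewrite scale0r.
Qed.

Let ext_linear : linear ext.
Proof.
move=> c u v; pose d := (msupp (c *: u + v) `|` (msupp u `|` msupp v))%fset.
rewrite !(@extE d) ?fsubsetUl //; last first.
- by rewrite fsubsetU // fsubsetUl orbT.
- by rewrite fsubsetU // fsubsetUr orbT.
rewrite scaler_sumr -big_split /=; apply: eq_bigr => w _.
by rewrite mcoeffD mcoeffZ scalerDl scalerA.
Qed.

Let extD u v : ext (u + v) = ext u + ext v.
Proof. by have := ext_linear 1 u v; rewrite !scale1r. Qed.

Let ext0 : ext 0 = 0.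
Proof. by apply: (addIr (ext 0)); rewrite -extD !add0r. Qed.

Let extZ c u : ext (c *: u) = c *: ext u.
Proof. by have := ext_linear c u 0; rewrite ext0 !addr0. Qed.

Let extB u v : ext (u - v) = ext u - ext v.
Proof. by rewrite -[- v]scaleN1r extD extZ scaleN1r. Qed.

Let extU w : ext << w >> = h w.
Proof. by rewrite (extE msuppU_le) big_seq_fset1 mcoeffUU scale1r. Qed.

Let sand l r (u : F) : V := ext (<< l >> * u * << r >>).

Let sandD l r u v : sand l r (u + v) = sand l r u + sand l r v.
Proof. by rewrite /sand [_ * (_ + _)]mulrDr [_ * << r >>]mulrDl extD. Qed.

Let sandZ l r c u : sand l r (c *: u) = c *: sand l r u.
Proof. by rewrite /sand -free_scalerAr -scalerAl extZ. Qed.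

Let sandB l r u v : sand l r (u - v) = sand l r u - sand l r v.
Proof. by rewrite -[- v]scaleN1r sandD sandZ scaleN1r. Qed.

Let sand_word l r w : sand l r << w >> = h (fmmul (fmmul l w) r).
Proof. by rewrite /sand free_wordM free_wordM extU. Qed.

Let sand_gen l r b a : sand l r (free_gen k (b, a)) =
  f (\prod_(p <- l) p.1 * b * \prod_(p <- r) p.1)
    (\prod_(p <- l) p.2 * a * \prod_(p <- r) p.2).
Proof.
by rewrite sand_word /h !fmmulE fmuE /= !big_cat /= !big_seq1.
Qed.

Let sand_rel l r u v : tensor_rel u v -> sand l r (u - v) = 0.
Proof.
have fDl b b' a : f (b + b') a = f b a + f b' a.
  by have := flinl a 1 b b'; rewrite !scale1r.
have fDr b a a' : f b (a + a') = f b a + f b a'.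
  by have := flinr b 1 a a'; rewrite !scale1r.
have f0l a : f 0 a = 0 by apply: (addIr (f 0 a)); rewrite -fDl !add0r.
have f0r b : f b 0 = 0 by apply: (addIr (f b 0)); rewrite -fDr !add0r.
have fZl c b a : f (c *: b) a = c *: f b a.
  by have := flinl a c b 0; rewrite f0l !addr0.
have fZr c b a : f b (c *: a) = c *: f b a.
  by have := flinr b c a 0; rewrite f0r !addr0.
move=> uv; rewrite sandB; apply/eqP; rewrite subr_eq0; apply/eqP.
case: uv => [b b' a|b a a'|c b a|c b a|b b' a a'|].
- by rewrite sandD !sand_gen mulrDr mulrDl fDl.
- by rewrite sandD !sand_gen mulrDr mulrDl fDr.
- by rewrite sandZ !sand_gen -scalerAr -scalerAl fZl.
- by rewrite sandZ !sand_gen -scalerAr -scalerAl fZr.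
- rewrite sand_gen {1}/free_gen {1}/free_gen free_wordM sand_word /h.
  by rewrite !fmmulE !fmuE /= !big_cat /= !big_cons !big_nil !mulr1 !mulrA.
- rewrite sand_gen !mulr1 (_ : 1 = << fmone (B * A)%type >>) // sand_word /h.
  by rewrite !fmmulE fmoneE /= !big_cat /= !big_nil !mulr1.
Qed.

Lemma tensor_lift :
  exists phi : {linear tensor -> V}, forall b a, phi (tens b a) = f b a.
Proof.
have killw u : rel_ideal tensor_rel u -> forall l r : W, sand l r u = 0.
  have mid (w : F) (T : F -> F) :
      (forall c x y, T (c *: x + y) = c *: T x + T y) ->
      (forall v : W, ext (T << v >>) = 0) -> ext (T w) = 0.
    move=> Tlin T0; rewrite [w]monalgE.
    have Tz : T 0 = 0 by have := Tlin (-1) 0 0; rewrite !scaleN1r !addNr.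
    elim: (enum_fset _) => [|v s IHs]; first by rewrite big_nil Tz ext0.
    by rewrite big_cons free_wordZ Tlin extD extZ T0 scaler0 add0r.
  elim=> [x y xy l r||x y _ IHx _ IHy l r|w x _ IHx l r|w x _ IHx l r].
  - exact: sand_rel.
  - by move=> l r; rewrite /sand mulr0 mul0r ext0.
  - by rewrite sandD IHx IHy addr0.
  - apply: (mid w (fun w => << l >> * (w * x) * << r >>)) => [c y z|v].
      by rewrite mulrDl mulrDr mulrDl -scalerAl -free_scalerAr -scalerAl.
    by rewrite mulrA free_wordM; apply: IHx.
  - apply: (mid w (fun w => << l >> * (x * w) * << r >>)) => [c y z|v].
      by rewrite mulrDr mulrDr mulrDl -!free_scalerAr -scalerAl.
    by rewrite mulrA -mulrA free_wordM; apply: IHx.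
have kill u : rel_ideal tensor_rel u -> ext u = 0.
  by move=> /killw/(_ mone mone); rewrite /sand mul1r mulr1.
pose phi (x : tensor) := ext (repr x).
have phi_pi u : phi (pres_pi tensor_rel u) = ext u.
  by apply/eqP; rewrite -subr_eq0 -extB; apply/eqP/kill/pres_repr.
have phi_lin : linear phi.
  move=> c x y; rewrite -[x]pres_piK -[y]pres_piK -pres_piZ -raddfD.
  by rewrite !phi_pi extD extZ.
pose phiL := GRing.isLinear.Build k tensor V *:%R phi phi_lin.
pose Phi : {linear tensor -> V} := HB.pack phi phiL.
exists Phi => b a; rewrite /= /tens /pres_gen phi_pi.
by rewrite /free_gen extU /h fmuE !big_seq1.
Qed.
End Lift.

End Tensor.

(* B[[t]]: a series is its sequence of coefficients. *)
Definition powser (B : pzRingType) : Type := nat -> B.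

Section PowerSeries.
Variable B : pzRingType.
Implicit Types f g h : powser B.

HB.instance Definition _ := gen_eqMixin (powser B).
HB.instance Definition _ := gen_choiceMixin (powser B).

Definition ps_zero : powser B := fun=> 0.
Definition ps_opp f : powser B := fun l => - f l.
Definition ps_add f g : powser B := fun l => f l + g l.
Definition ps_one : powser B := fun l => (l == 0%N)%:R.
Definition ps_mul f g : powser B := fun l => \sum_(i < l.+1) f i * g (l - i)%N.

Fact ps_addA : associative ps_add.
Proof. by move=> f g h; apply/funext=> l; apply: addrA. Qed.
Fact ps_addC : commutative ps_add.
Proof. by move=> f g; apply/funext=> l; apply: addrC. Qed.
Fact ps_add0 : left_id ps_zero ps_add.
Proof. by move=> f; apply/funext=> l; apply: add0r. Qed.
Fact ps_addN : left_inverse ps_zero ps_opp ps_add.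
Proof. by move=> f; apply/funext=> l; apply: addNr. Qed.

HB.instance Definition _ :=
  GRing.isZmodule.Build (powser B) ps_addA ps_addC ps_add0 ps_addN.

Fact ps_mulA : associative ps_mul.
Proof.
move=> f g h; apply/funext=> l; rewrite /ps_mul.
pose s i j := f i * g (j - i)%N * h (l - j)%N.
transitivity (\sum_(i < l.+1) \sum_(j < l.+1 | (i <= j)%N) s i j).
  apply: eq_bigr => i _; rewrite mulr_sumr.
  have le_il : (i <= l)%N by rewrite -ltnS.
  rewrite (reindex_onto (fun j : 'I_(l - i).+1 => inord (i + j) : 'I_l.+1)
                        (fun j : 'I_l.+1 => inord (j - i))) /=; last first.
    move=> j le_ij; have le_jl : (j <= l)%N by rewrite -ltnS.
    have lt_ji : (j - i < (l - i).+1)%N by rewrite ltnS leq_sub2r.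
    by apply: val_inj; rewrite /= !inordK ?subnKC.
  have val_ij : forall j : 'I_(l - i).+1,
      (inord (i + j) : 'I_l.+1) = (i + j)%N :> nat.
    by move=> j; rewrite inordK // ltnS -leq_subRL // -ltnS ltn_ord.
  apply: eq_big => [j|j _]; last by rewrite /s val_ij addKn subnDA mulrA.
  by rewrite val_ij leq_addr addKn; apply/esym/eqP/val_inj; rewrite /= inordK.
rewrite (exchange_big_dep xpredT) //=; apply: eq_bigr => j _; rewrite mulr_suml.
rewrite (reindex_onto (fun i : 'I_j.+1 => inord i : 'I_l.+1)
                      (fun i : 'I_l.+1 => inord i)) /=; last first.
  by move=> i le_ij; apply: val_inj => /=; rewrite !inordK.
have val_i : forall i : 'I_j.+1, (inord i : 'I_l.+1) = i :> nat.
  by move=> i; rewrite inordK // (leq_trans (ltn_ord i)).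
apply: eq_big => [i|i _]; last by rewrite /s val_i.
by rewrite val_i -ltnS ltn_ord; apply/eqP/val_inj; rewrite /= inordK.
Qed.

Fact ps_mul1 : left_id ps_one ps_mul.
Proof.
move=> f; apply/funext=> l; rewrite /ps_mul big_ord_recl subn0 mul1r.
by rewrite big1 ?addr0 // => i _; rewrite mul0r.
Qed.
Fact ps_mulr1 : right_id ps_one ps_mul.
Proof.
move=> f; apply/funext=> l; rewrite /ps_mul big_ord_recr /= subnn mulr1.
rewrite big1 ?add0r // => i _.
by rewrite /ps_one subn_eq0 leqNgt ltn_ord mulr0.
Qed.
Fact ps_mulDl : left_distributive ps_mul +%R.
Proof.
move=> f g h; apply/funext=> l; rewrite -[RHS]/(ps_mul f h l + ps_mul g h l).
by rewrite -big_split; apply: eq_bigr => i _; apply: mulrDl.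
Qed.
Fact ps_mulDr : right_distributive ps_mul +%R.
Proof.
move=> f g h; apply/funext=> l; rewrite -[RHS]/(ps_mul f g l + ps_mul f h l).
by rewrite -big_split; apply: eq_bigr => i _; apply: mulrDr.
Qed.

HB.instance Definition _ := GRing.Zmodule_isPzRing.Build (powser B)
  ps_mulA ps_mul1 ps_mulr1 ps_mulDl ps_mulDr.

End PowerSeries.

Section MasterTheorem.
Variables (k : fieldType) (n : nat) (q : 'I_n -> 'I_n -> k).

Local Notation A := (qspace q).
Local Notation B := (qmat q).
Local Notation mindex := {ffun 'I_n -> nat}.

(* [c] is the finitely supported family of B-coefficients of [u]. *)
Definition is_Bexpansion (u : tensor B A) (c : {malg B[mindex]}) : Prop :=
  u = \sum_(m <- msupp c) tens c@_m (qx_mon q m).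

(* Every u has exactly one expansion, the x^m being a k-basis of A. *)
Definition Bcoef (u : tensor B A) (m : mindex) : B :=
  (xget 0 [set c | is_Bexpansion u c])@_m.

Definition qX (i : 'I_n) : tensor B A := \sum_(j < n) tens (qz q i j) (qx q j).

Definition qX_mon (m : mindex) : tensor B A := \prod_(i < n) qX i ^+ m i.

Definition Gcoef (m : mindex) : B := Bcoef (qX_mon m) m.

(* A multi-index m with |m| = l has all its entries at most l. *)
Definition Bos : powser B := fun l =>
  \sum_(m : {ffun 'I_n -> 'I_l.+1} | (\sum_(i < n) m i == l)%N)
     Gcoef [ffun i => m i : nat].

(* [jth J a] is the a-th smallest element of J, for a < #|J|. *)
Definition jth (J : {set 'I_n}) (a : 'I_#|J|) : 'I_n := enum_val a.

Definition inv_weight (J : {set 'I_n}) (p : 'S_#|J|) : k :=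
  \prod_(a < #|J|) \prod_(b < #|J| | (a < b)%N && (p b < p a)%N)
     (- q (jth (p b)) (jth (p a)))^-1.

Definition qdet (J : {set 'I_n}) : B :=
  \sum_(p : 'S_#|J|)
     inv_weight p *: \prod_(a < #|J|) qz q (jth (p a)) (jth a).

Definition Ferm : powser B := fun m =>
  \sum_(J : {set 'I_n} | #|J| == m) (-1) ^+ m * qdet J.

End MasterTheorem.

(* Main.v *)
(* The X_i satisfy the same q-commutation relations as the x_i, so
   c m m', the coefficient of x^m' in X^m, obeys a recursion on right
   multiplication by X_j.  Together with the quantum minors it gives, in each
   multidegree mu, an endomorphism of the degree mu part of the quantum Koszul
   complex, which has a basis indexed by the subsets J of the support of mu.
   For mu != 0 this complex is contractible, so the supertrace of the
   endomorphism, \sum_J (-1)^|J| G(mu - 1_J) det_q(Z_J), vanishes; these sums are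
   the coefficients of Bos * Ferm. *)
Require Import Defs.
From mathcomp Require Import finmap boolp classical_sets.
From mathcomp Require Import all_boot all_order all_algebra all_fingroup.
From mathcomp Require Import generic_quotient.
From mathcomp Require Import ring.
From mathcomp.multinomials Require Import monalg.

Set Implicit Arguments.
Unset Strict Implicit.
Unset Printing Implicit Defensive.

Import GRing.Theory.
Local Open Scope ring_scope.

(** Traces of matrices over the noncommutative [B] are not cyclic. The argument survives because the
    Koszul differential and its homotopy have scalar entries; only the chain map has entries in [B].
    Each of these is a coefficient times a minor, in this order: the recursion for coefficients
    appends some [z_j^l] on the right, and expanding a minor along its first upper index splits off
    such a factor on the left. This fixes the order of the two series in the theorem. Since the
    [q_ij] are nonzero, the entries of the differential are invertible, and any index of the support
    of [mu] yields a homotopy. The relations of [B] serve twice: they make the [X_i] q-commute, and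
    they make the minors alternate, up to weights, in their upper indices. As [A] and the tensor
    product are given by presentations, the coefficients need an independent construction: a linear
    functional weighting words by their inversions kills the defining ideal of [A], separates the
    monomials and extends to the tensor product by its universal property. *)

(** * Cancellation in pairs, and the supertrace over a contractible complex *)

Lemma sum_pairs_eq0 (V : zmodType) n (f : 'I_n -> 'I_n -> V) :
  (forall i, f i i = 0) ->
  (forall i j : 'I_n, (i < j)%N -> f i j + f j i = 0) ->
  \sum_i \sum_j f i j = 0.
Proof.
move=> f0 fD.
have split_lt i : \sum_j f i j =
    \sum_(j < n) (if (i < j)%N then f i j else 0) +
    \sum_(j < n) (if (j < i)%N then f i j else 0).
  rewrite -big_split /=; apply: eq_bigr => j _.
  by case: ltngtP => [||/val_inj->]; rewrite ?addr0 ?add0r.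
under eq_bigr do rewrite split_lt.
rewrite big_split /= [X in _ + X]exchange_big -big_split /=.
rewrite big1 // => i _; rewrite -big_split big1 // => j _ /=.
by case: ifP => [/fD//|_]; rewrite addr0.
Qed.

(* The differential sends J to the sum of the a J j (J :\ j) over j in J; adding
   i to J, divided by a (i |: J) i, is a contracting homotopy.  Both change the
   sign (-1)^|J|, so the supertrace of a chain map M vanishes. *)
Lemma supertrace_eq0 (k : fieldType) (V : lmodType k) (T : finType)
  (S : {set T}) (i : T) (a : {set T} -> T -> k) (M : {set T} -> {set T} -> V) :
  i \in S ->
  (forall (J : {set T}) j, J \subset S -> j \in J -> a J j != 0) ->
  (forall (J : {set T}) j l, J \subset S -> j \in J -> l \in J -> j != l ->
    a J j * a (J :\ j) l + a J l * a (J :\ l) j = 0) ->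
  (forall J J' : {set T}, J \subset S -> J' \subset S ->
    \sum_(j in J) a J j *: M (J :\ j) J' =
    \sum_(j in S :\: J') a (j |: J') j *: M J (j |: J')) ->
  \sum_(J : {set T} | J \subset S) (-1) ^+ #|J| *: M J J = 0.
Proof.
move=> iS a0 aD MD.
pose L (J : {set T}) := (J \subset S) && (i \notin J).
have LP (J : {set T}) : L J -> [/\ J \subset S, i \notin J & i |: J \subset S].
  by case/andP=> JS iJ; split; rewrite // subUset sub1set iS.
(* Pair each [J] avoiding [i] with [i |: J], which carries the opposite sign. *)
have -> : \sum_(J : {set T} | J \subset S) (-1) ^+ #|J| *: M J J =
    \sum_(J | L J) (-1) ^+ #|J| *: (M J J - M (i |: J) (i |: J)).
  rewrite (bigID (fun J : {set T} => i \in J)) /= addrC.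
  under [RHS]eq_bigr do rewrite scalerBr.
  rewrite sumrB; congr (_ + _).
  rewrite (reindex_onto (fun J => i |: J) (fun J => J :\ i)) /=; last first.
    by move=> J /andP[_ iJ]; rewrite setD1K.
  rewrite -sumrN; apply: eq_big => [J|J].
    rewrite setU11 andbT subUset sub1set iS /= /L; congr (_ && _).
    apply/eqP/idP => [<-|iJ]; first by rewrite setD11.
    by rewrite setU1K.
  case/andP=> _ /eqP JE; have iJ: i \notin J by rewrite -JE setD11.
  by rewrite cardsU1 iJ exprS mulN1r scaleNr.
(* [r J j] is the entry, from [J] to [i |: (J :\ j)], of the homotopy followed by the
   differential. *)
pose r (J : {set T}) j := a (i |: J) j / a (i |: J) i.
pose f (J : {set T}) j := (-1) ^+ #|J| *: (r J j *: M (i |: (J :\ j)) J).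
have fE (J : {set T}) j : L J -> j \in S -> j \notin J -> j != i ->
    (-1) ^+ #|J| *: ((a (i |: J) i)^-1 *: (a (j |: J) j *: M (i |: J) (j |: J))) =
    f (j |: J) j.
  case/LP=> JS iJ iJS jS jJ ji.
  have jJS : j |: J \subset S by rewrite subUset sub1set jS.
  have KS : i |: (j |: J) \subset S by rewrite subUset sub1set iS.
  have inK : i \in i |: (j |: J) by rewrite setU11.
  have jnK : j \in i |: (j |: J) by rewrite !inE eqxx orbT.
  have ij : i != j by rewrite eq_sym.
  (* The square of the differential vanishes at [i |: (j |: J)], so [a (j |: J) j / a (i |: J) i] is
     [- r (j |: J) j]; the sign is absorbed by the change of cardinality. *)
  have := aD _ i j KS inK jnK ij.
  have ijJ : i \notin j |: J by rewrite !inE negb_or ij.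
  have jiJ : j \notin i |: J by rewrite !inE negb_or ji.
  rewrite setU1K // [in _ :\ j]setUCA setU1K // => /eqP.
  rewrite addr_eq0 => /eqP aE.
  have K0 : a (i |: (j |: J)) i != 0 by apply: a0.
  have i0 : a (i |: J) i != 0 by rewrite a0 ?setU11.
  rewrite /f /r setU1K // cardsU1 jJ exprS mulN1r scaleNr -scalerN -scaleNr !scalerA.
  congr (_ *: _); rewrite -mulrA; congr (_ * _); apply: (mulfI K0).
  by rewrite mulrCA aE !mulrN [in RHS]mulrCA mulfV // mulr1 mulrC mulfK.
have step (J : {set T}) : L J -> (-1) ^+ #|J| *: (M J J - M (i |: J) (i |: J)) =
    \sum_(j in S :\: J | j != i) f (j |: J) j - \sum_(j in J) f J j.
  move=> LJ; have [JS iJ iJS] := LP _ LJ.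
  have ai0 : a (i |: J) i != 0 by rewrite a0 ?setU11.
  (* In the chain relation for [i |: J] and [J], the two terms at [i] are the diagonal entries
     wanted, both with the invertible coefficient [a (i |: J) i]. *)
  have := MD (i |: J) J iJS JS.
  rewrite big_setU1 //= setU1K // [RHS](bigD1 i) /=; last by rewrite !inE iJ.
  move/(congr1 (fun x => (-1) ^+ #|J| *: ((a (i |: J) i)^-1 *: x))).
  rewrite !scalerDr !scalerA [_ * _^-1 * a _ i]mulfVK // !scaler_sumr.
  have -> : \sum_(j in S :\: J | j != i)
      ((-1) ^+ #|J| / a (i |: J) i) *: (a (j |: J) j *: M (i |: J) (j |: J)) =
      \sum_(j in S :\: J | j != i) f (j |: J) j.
    by apply: eq_bigr => j /andP[]; rewrite !inE => /andP[jJ jS] ji; rewrite -scalerA; apply: fE.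
  have -> : \sum_(j in J)
      ((-1) ^+ #|J| / a (i |: J) i) *: (a (i |: J) j *: M ((i |: J) :\ j) J) =
      \sum_(j in J) f J j.
    apply: eq_bigr => j jJ; rewrite /f /r [a _ j / _]mulrC !scalerA mulrA.
    congr (_ *: M _ _); rewrite setDUl; congr (_ :|: _).
    apply/setP=> x; rewrite !inE; case: (x =P i) => [->|]; rewrite ?andbF //.
    by rewrite andbT; apply: contraNneq iJ => ->.
  move=> E; apply/eqP; rewrite scalerN subr_eq addrAC eq_sym subr_eq.
  by rewrite E addrC.
rewrite (eq_bigr _ step) sumrB; apply/eqP; rewrite subr_eq0; apply/eqP.
rewrite !pair_big_dep /=.
(* Summed over all [J], the two families of terms coincide under the shift of [(J, j)] to
   [(j |: J, j)]. *)
rewrite [RHS](reindex_onto (fun p => (p.2 |: p.1, p.2)) (fun p => (p.1 :\ p.2, p.2))) /=.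
  apply: eq_bigl => -[J j] /=; rewrite !inE /= eqxx xpair_eqE eqxx !andbT /L.
  rewrite subUset sub1set !inE !negb_or.
  have -> : ((j |: J) :\ j == J) = (j \notin J).
    by apply/eqP/idP => [<-|/setU1K//]; rewrite setD11.
  rewrite [i == j]eq_sym.
  by case: (J \subset S); case: (i \in J); case: (j \in J); case: (j == i); rewrite ?andbF ?andbT.
by case=> J j /= /andP[_ jJ]; rewrite setD1K.
Qed.

(** * Ordered monomials in q-commuting elements, and normal ordering of words *)

Section QuantumMonomials.
Variables (k : fieldType) (n : nat) (q : 'I_n -> 'I_n -> k).
Local Notation mindex := {ffun 'I_n -> nat}.
Implicit Types (m : mindex) (i j l : 'I_n) (J : {set 'I_n}).

Definition mincr m j : mindex := [ffun l => m l + (l == j)]%N.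

(** The subtraction is truncated: this is [m - 1_J] only if [J] lies in the support of [m]. *)
Definition mdecr m J : mindex := [ffun l => m l - (l \in J)]%N.

(** The scalar produced when [x_j] moves left from the end of [x^m] to its place, past the powers of
    the [x_l] with [l > j]. *)
Definition qshift m j : k := \prod_(l < n | (j < l)%N) q j l ^+ m l.

Lemma sorted_index_enum_ord : sorted (fun i j => i < j)%N (index_enum 'I_n).
Proof.
have := iota_ltn_sorted 0 n.
by rewrite -val_enum_ord sorted_map enumT [index_enum _]unlock.
Qed.

Section QCommuting.
(* [tensor] has no declared algebra structure, whence the scaling [sc]. *)
Variables (R : pzRingType) (sc : k -> R -> R).
Hypothesis sc1 : forall x, sc 1 x = x.
Hypothesis scA : forall a b x, sc a (sc b x) = sc (a * b) x.
Hypothesis scMl : forall a x y, sc a x * y = sc a (x * y).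
Hypothesis scMr : forall a x y, x * sc a y = sc a (x * y).
Variable y : 'I_n -> R.
Hypothesis yC : forall i j, (i < j)%N -> y j * y i = sc (q i j) (y i * y j).

Lemma qcommX i j a :
  (i < j)%N -> y j ^+ a * y i = sc (q i j ^+ a) (y i * y j ^+ a).
Proof.
move=> ij; elim: a => [|a IH]; first by rewrite !expr0 mul1r mulr1 sc1.
by rewrite [y j ^+ _]exprS -mulrA IH scMr mulrA yC // scMl scA -exprSr -mulrA.
Qed.

Lemma qcomm_prod (s : seq 'I_n) m j : all (fun l : 'I_n => j < l)%N s ->
  (\prod_(l <- s) y l ^+ m l) * y j =
  sc (\prod_(l <- s) q j l ^+ m l) (y j * \prod_(l <- s) y l ^+ m l).
Proof.
elim: s => [|l s IH] /=; first by rewrite !big_nil mul1r mulr1 sc1.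
case/andP=> jl /IH {}IH; rewrite !big_cons -mulrA IH scMr mulrA qcommX //.
by rewrite scMl scA -mulrA mulrC.
Qed.

(** Induction along the increasing list of indices: the new factor passes everything after [j], and
    what precedes [j] is untouched. It serves both the [x_i] in [A] and the [X_i] in the tensor
    product. *)
Lemma qmon_mulr m j :
  (\prod_(l < n) y l ^+ m l) * y j =
  sc (qshift m j) (\prod_(l < n) y l ^+ mincr m j l).
Proof.
rewrite /qshift; have := mem_index_enum j; move: sorted_index_enum_ord.
elim: (index_enum _) => //= l s IH sl; rewrite inE !big_cons.
have lts: all (fun i : 'I_n => l < i)%N s.
  by apply: order_path_min sl => a b c; apply: ltn_trans.
have [-> _|jl /= js] := eqVneq j l.
  rewrite ltnn -mulrA qcomm_prod // scMr mulrA -exprSr ffunE eqxx addn1.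
  congr (sc _ (_ * _)).
    rewrite -[RHS]big_filter; congr (bigop _ _ _).
    by apply/esym/all_filterP; apply: lts.
  rewrite !big_seq; apply: eq_bigr => i /(allP lts) li.
  by rewrite ffunE; case: eqP li => [->|]; rewrite ?ltnn ?addn0.
have lj : (l < j)%N by apply: (allP lts).
rewrite ltnNge ltnW //= -mulrA IH ?(path_sorted sl) // scMr ffunE.
by rewrite eq_sym (negbTE jl) addn0.
Qed.

End QCommuting.

Local Notation A := (qspace q).

Lemma qxC i j : (i < j)%N -> qx q j * qx q i = q i j *: (qx q i * qx q j).
Proof.
move=> ij; rewrite /qx /pres_gen -!pres_piM -pres_piZ.
by apply/pres_piP/rel_ideal_base; constructor.
Qed.

Lemma qx_mon_mulr m j : qx_mon q m * qx q j = qshift m j *: qx_mon q (mincr m j).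
Proof.
apply: (qmon_mulr (sc := *:%R)) => [x|a b x|a x y|a x y|].
- exact: scale1r.
- exact: scalerA.
- exact/esym/scalerAl.
- exact/esym/scalerAr.
- exact: qxC.
Qed.

Lemma qword_span (w : {fmonom 'I_n}) :
  exists c m, pres_pi (@qspace_rel k n q) << w >> = c *: qx_mon q m.
Proof.
case: w => w; elim/last_ind: w => [|w j [c [m IH]]].
  exists 1, [ffun=> 0%N]; rewrite scale1r /qx_mon big1 => [|i _].
    by rewrite -fmoneE.
  by rewrite ffunE.
exists (c * qshift m j), (mincr m j); rewrite -scalerA -qx_mon_mulr.
rewrite [RHS]pres_scalerAl -IH /qx /pres_gen -pres_piM; congr pres_pi.
by rewrite free_wordM fmmulE fmuE /= cats1.
Qed.

Lemma qspace_ind (P : A -> Prop) :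
  P 0 -> (forall c m a, P a -> P (c *: qx_mon q m + a)) -> forall a, P a.
Proof.
move=> P0 PD a; rewrite -[a]pres_piK [repr a]monalgE raddf_sum /=.
elim: (enum_fset _) => [|w s IH]; first by rewrite big_nil.
rewrite big_cons free_wordZ pres_piZ.
by have [c [m ->]] := qword_span w; rewrite scalerA; apply: PD.
Qed.

(** Normal-ordering weight, one factor for each pair of letters in decreasing order: the word [x_w]
    is this scalar times an ordered monomial. *)
Fixpoint qweight (w : seq 'I_n) : k :=
  if w is j :: w' then qweight w' * \prod_(l <- w' | (l < j)%N) q l j else 1.

(* The coefficient of x^m in the word x_w. *)
Definition qword_coef m (w : {fmonom 'I_n}) : k :=
  qweight w *+ ([ffun i => count_mem i w] == m).

Definition qcoef m (a : A) : k := mmap idfun (qword_coef m) (repr a).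

(** Both words have the same letters, and their inversions differ only by the pair [j], [i]. *)
Lemma qword_coef_swap m (u v : seq 'I_n) i j : (i < j)%N ->
  qword_coef m (FMonom (u ++ j :: i :: v)) =
  q i j * qword_coef m (FMonom (u ++ i :: j :: v)).
Proof.
move=> ij; rewrite /qword_coef /= mulrnAr.
have pij : perm_eq (u ++ j :: i :: v) (u ++ i :: j :: v).
  by rewrite perm_cat2l (perm_catCA [:: j] [:: i]).
congr (_ *+ (_ == m)); last first.
  by apply/ffunP=> l; rewrite !ffunE; apply/seq.permP.
elim: u {pij} => [|l u IH] /=.
  by rewrite !big_cons ij ltnNge (ltnW ij) /= mulrCA mulrAC.
by rewrite IH mulrA; congr (_ * _); apply: perm_big; rewrite perm_cat2l (perm_catCA [:: j] [:: i]).
Qed.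

Lemma mmap_linear (G : choiceType) (h : {fmonom G} -> k) :
  scalar (mmap idfun h).
Proof.
move=> c u v; rewrite raddfD /=; congr (_ + _).
rewrite (mmapEw (msuppZ_le c u)) mmapE mulr_sumr.
by apply: eq_bigr => w _; rewrite mcoeffZ mulrA.
Qed.

(** The induction on the ideal multiplies by arbitrary elements on either side. Expanding these into
    words reduces everything to relations placed between two words. *)
Lemma functional_ideal (G : choiceType) (rel : free_alg k G -> free_alg k G -> Prop)
    (F : free_alg k G -> k) (u : free_alg k G) : scalar F ->
    (forall (l r : {fmonom G}) u v, rel u v -> F (<< l >> * (u - v) * << r >>) = 0) ->
  rel_ideal rel u -> F u = 0.
Proof.
move=> Flin F0 Iu; have FD (x y : free_alg k G) : F (x + y) = F x + F y.
  by have := Flin 1 x y; rewrite scale1r mul1r.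
have Fz : F 0 = 0 by apply: (addIr (F 0)); rewrite -FD !add0r.
have FZ c (x : free_alg k G) : F (c *: x) = c * F x by have := Flin c x 0; rewrite Fz !addr0.
have sum0 (T : free_alg k G -> free_alg k G) w :
    (forall c (x y : free_alg k G), T (c *: x + y) = c *: T x + T y) ->
    (forall v : {fmonom G}, F (T << v >>) = 0) -> F (T w) = 0.
  move=> Tlin T0; rewrite [w]monalgE.
  have Tz : T 0 = 0 by have := Tlin (-1) 0 0; rewrite !scaleN1r !addNr.
  elim: (enum_fset _) => [|v s IHs]; first by rewrite big_nil Tz Fz.
  by rewrite big_cons free_wordZ Tlin FD FZ T0 mulr0 add0r.
pose sand (l r : {fmonom G}) (u : free_alg k G) : k := F (<< l >> * u * << r >>).
have sandD (l r : {fmonom G}) x y : sand l r (x + y) = sand l r x + sand l r y.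
  by rewrite /sand [_ * (_ + _)]mulrDr [_ * << r >>]mulrDl FD.
suff H (l r : {fmonom G}) : sand l r u = 0.
  by have := H mone mone; rewrite /sand mul1r mulr1.
elim: Iu l r => [x y xy l r||x y _ IHx _ IHy l r|w x _ IHx l r|w x _ IHx l r].
- exact (F0 l r x y xy).
- by move=> l r; rewrite /sand mulr0 mul0r Fz.
- by rewrite sandD IHx IHy addr0.
- apply: (sum0 (fun w => << l >> * (w * x) * << r >>)) => [c y z|v].
    by rewrite mulrDl mulrDr mulrDl -scalerAl -free_scalerAr -scalerAl.
  by rewrite mulrA free_wordM; apply: IHx.
- apply: (sum0 (fun w => << l >> * (x * w) * << r >>)) => [c y z|v].
    by rewrite mulrDr mulrDr mulrDl -!free_scalerAr -scalerAl.
  by rewrite mulrA -mulrA free_wordM; apply: IHx.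
Qed.

(** The word functional descends to [A], so [qcoef] does not depend on the representative chosen by
    [repr]. *)
Lemma qcoef_pi m u : qcoef m (pres_pi (@qspace_rel k n q) u) = mmap idfun (qword_coef m) u.
Proof.
have Flin := @mmap_linear _ (qword_coef m).
apply/eqP; rewrite -subr_eq0 -raddfB; apply/eqP.
apply: (functional_ideal Flin _ (pres_repr _ u)) => l r _ _ [i j ij].
have FZ c x : mmap idfun (qword_coef m) (c *: x) = c * mmap idfun (qword_coef m) x.
  by have := Flin c x 0; rewrite raddf0 !addr0.
rewrite [<< l >> * _]mulrBr [_ * << r >>]mulrBl.
rewrite -free_scalerAr -[(_ *: _) * _]scalerAl raddfB /= FZ.
rewrite /free_gen !free_wordM !mmapU !fmmulE !fmuE /= -!catA /= !mul1r.
rewrite qword_coef_swap //.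
by rewrite subrr.
Qed.

End QuantumMonomials.

(** * Coefficient functionals on quantum space *)

Section QuantumCoefficients.
Variables (k : fieldType) (n : nat) (q : 'I_n -> 'I_n -> k).
Local Notation mindex := {ffun 'I_n -> nat}.
Local Notation A := (qspace q).
Implicit Types (m : mindex) (i j l : 'I_n).

Lemma qcoef_scalar m : scalar (qcoef m : A -> k).
Proof.
move=> c a b; rewrite -[a]pres_piK -[b]pres_piK -pres_piZ -raddfD /=.
by rewrite !qcoef_pi mmap_linear.
Qed.

(** The monomial is the image of a sorted word, which has no inversion and hence weight 1. This is
    the linear independence of the monomials. *)
Lemma qcoef_mon m m' : qcoef m (qx_mon q m') = (m' == m)%:R.
Proof.
pose w := flatten [seq nseq (m' i) i | i <- index_enum 'I_n].
have -> : qx_mon q m' = pres_pi _ << FMonom w >>.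
  rewrite /qx_mon /w; elim: (index_enum _) => [|i s IH] /=.
    by rewrite big_nil -fmoneE.
  rewrite big_cons IH; elim: (m' i) => [|a IHa] /=; first by rewrite expr0 mul1r.
  rewrite exprS -[_ * _ * pres_pi _ _]mulrA IHa /qx /pres_gen -pres_piM.
  by rewrite /free_gen free_wordM fmmulE fmuE.
rewrite qcoef_pi mmapU mul1r /qword_coef.
have -> : qweight q w = 1.
  rewrite /w; have := sorted_index_enum_ord n.
  elim: (index_enum _) => //= i s IH si.
  elim: (m' i) => [|a IHa] /=; first by rewrite IH ?(path_sorted si).
  rewrite IHa mul1r big_seq_cond big1 // => l /andP[]; rewrite mem_cat mem_nseq.
  case/orP=> [/andP[_ /eqP->]|]; first by rewrite ltnn.
  case/flatten_mapP=> j js; rewrite mem_nseq => /andP[_ /eqP->].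
  have lts: all (fun j : 'I_n => i < j)%N s.
    by apply: order_path_min si => u v x; apply: ltn_trans.
  by rewrite ltnNge (ltnW (allP lts _ js)).
congr (_%:R : k); congr nat_of_bool; congr (_ == _); apply/ffunP=> i; rewrite ffunE /=.
rewrite count_flatten -map_comp sumnE big_map.
rewrite (bigD1_seq i) ?mem_index_enum ?index_enum_uniq //= count_nseq /= eqxx mul1n.
by rewrite big1 ?addn0 // => j ji; rewrite count_nseq /= (negbTE ji) mul0n.
Qed.

Lemma mincrK m j : mdecr (mincr m j) [set j] = m.
Proof. by apply/ffunP=> l; rewrite !ffunE inE addnK. Qed.

Lemma mdecrK m j : (0 < m j)%N -> mincr (mdecr m [set j]) j = m.
Proof.
by move=> mj; apply/ffunP=> l; rewrite !ffunE inE; case: eqP => [->|]; rewrite ?subn0 ?addn0 ?subnK.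
Qed.

Lemma qcoef0 m : qcoef m (0 : A) = 0.
Proof. by have := qcoef_scalar m (-1) 0 0; rewrite scaler0 addr0 mulN1r addNr. Qed.

Lemma qcoef_mulr m a j : qcoef m (a * qx q j) =
  if (0 < m j)%N then qshift q (mdecr m [set j]) j * qcoef (mdecr m [set j]) a else 0.
Proof.
elim/qspace_ind: a => [|c m' a IH].
  by rewrite mul0r !qcoef0 mulr0; case: ifP.
rewrite [_ * qx q j]mulrDl -[_ *: _ * _]scalerAl qx_mon_mulr !qcoef_scalar.
rewrite [qcoef _ (_ *: _)](_ : _ = qshift q m' j * (mincr m' j == m)%:R); last first.
  by have := qcoef_scalar m (qshift q m' j) (qx_mon q (mincr m' j)) 0; rewrite addr0 qcoef0 addr0 qcoef_mon.
rewrite IH qcoef_mon; case: ifP => [mj|mj].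
  rewrite mulrDr mulrCA; congr (_ + _).
  rewrite (_ : (mincr m' j == m) = (m' == mdecr m [set j])); last first.
    by apply/eqP/eqP => [<-|->]; rewrite ?mincrK ?mdecrK.
  by case: eqP => [->|_]; rewrite ?mulr0.
rewrite addr0 (_ : (_ == m) = false) ?mulr0 //.
by apply: contraFF mj => /eqP <-; rewrite ffunE eqxx addn1.
Qed.

End QuantumCoefficients.

(** * Coefficients in the tensor product *)

Section TensorCoefficients.
Variables (k : fieldType) (n : nat) (q : 'I_n -> 'I_n -> k).
Local Notation mindex := {ffun 'I_n -> nat}.
Local Notation A := (qspace q).
Variable B : algType k.
Implicit Types (m : mindex) (i j l : 'I_n).

Lemma tensor_coef m :
  exists Phi : {linear tensor B A -> B}, forall b a, Phi (tens b a) = qcoef m a *: b.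
Proof.
apply: (@tensor_lift k B A B (fun b a => qcoef m a *: b)) => [a c b b'|b c a a'].
  by rewrite /= scalerDr !scalerA mulrC.
by rewrite /= qcoef_scalar scalerDl scalerA.
Qed.

Definition tcoef m : {linear tensor B A -> B} := sval (cid (tensor_coef m)).

Lemma tcoef_tens m b a : tcoef m (tens b a) = qcoef m a *: b.
Proof. exact: (svalP (cid (tensor_coef m))). Qed.

Lemma tcoef_mulr m u b j : tcoef m (u * tens b (qx q j)) =
  if (0 < m j)%N then qshift q (mdecr m [set j]) j *: (tcoef (mdecr m [set j]) u * b)
  else 0.
Proof.
have [s ->] := tensor_span u; rewrite mulr_suml !raddf_sum mulr_suml scaler_sumr.
transitivity (\sum_(p <- s) if (0 < m j)%N then
   qshift q (mdecr m [set j]) j *: (tcoef (mdecr m [set j]) (tens p.1 p.2) * b) else 0).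
  apply: eq_bigr => p _; rewrite /= tensM !tcoef_tens qcoef_mulr.
  by case: ifP => _; rewrite ?scale0r // -scalerAl scalerA.
by case: ifP => _; rewrite ?big1_eq.
Qed.

Lemma tcoef_mulr_sum (b : 'I_n -> B) m u :
  tcoef m (u * \sum_h tens (b h) (qx q h)) =
  \sum_h if (0 < m h)%N
    then qshift q (mdecr m [set h]) h *: (tcoef (mdecr m [set h]) u * b h) else 0.
Proof.
by rewrite mulr_sumr linear_sum; apply: eq_bigr => h _; apply: tcoef_mulr.
Qed.

Definition texpand (c : {malg B[mindex]}) : tensor B A :=
  \sum_(m <- msupp c) tens c@_m (qx_mon q m).

Lemma texpandE (d : {fset mindex}) c : (msupp c `<=` d)%fset ->
  texpand c = \sum_(m <- d) tens c@_m (qx_mon q m).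
Proof.
move=> le; rewrite [LHS](big_fset_incl _ le) => //= m _ /mcoeff_outdom ->.
by have := tensZl 0 (0 : B) (qx_mon q m); rewrite !scale0r.
Qed.

Lemma texpandD c d : texpand (c + d) = texpand c + texpand d.
Proof.
pose e := (msupp (c + d) `|` (msupp c `|` msupp d))%fset.
rewrite !(@texpandE e) ?fsubsetUl //; last first.
- by rewrite fsubsetU // fsubsetUl orbT.
- by rewrite fsubsetU // fsubsetUr orbT.
by rewrite -big_split /=; apply: eq_bigr => m _; rewrite mcoeffD tensDl.
Qed.

Lemma texpandU b m : texpand << b *g m >> = tens b (qx_mon q m).
Proof. by rewrite (texpandE msuppU_le) big_seq_fset1 mcoeffUU. Qed.

Lemma texpand_surj u : exists c, u = texpand c.
Proof.
have [s ->] := tensor_span u; elim: s => [|[b a] s [c IH]].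
  by exists 0; rewrite /texpand msupp0 !big_nil.
suff [d dE] : exists d, tens b a = texpand d.
  by exists (d + c); rewrite big_cons IH texpandD dE.
elim/qspace_ind: a => [|e m a [d IHa]].
  exists 0; rewrite /texpand msupp0 big_nil.
  by have := tensZr 0 b (0 : A); rewrite !scale0r.
by exists (<< e *: b *g m >> + d); rewrite tensDr IHa texpandD texpandU tensZr tensZl.
Qed.

(** Uniqueness of expansions; [texpand_surj] is their existence. *)
Lemma tcoef_expand m c : tcoef m (texpand c) = c@_m.
Proof.
rewrite /texpand raddf_sum /=.
under eq_bigr do rewrite tcoef_tens qcoef_mon.
have [ms|ms] := boolP (m \in msupp c).
  rewrite (bigD1_seq m) ?fset_uniq //= eqxx scale1r big1 ?addr0 // => m' /negbTE ->.
  by rewrite scale0r.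
rewrite mcoeff_outdom // big_seq_cond big1 // => m' /andP[m's _].
by rewrite (_ : (m' == m) = false) ?scale0r //; apply: contraNF ms => /eqP <-.
Qed.

End TensorCoefficients.

(** An expansion exists, so [xget] does not fall back on its default 0, and whichever expansion it
    picks has the coefficients read off by [tcoef]. *)
Lemma Bcoef_tcoef (k : fieldType) n (q : 'I_n -> 'I_n -> k) u m :
  Bcoef u m = tcoef q (qmat q) m u.
Proof.
have [c uc] := texpand_surj u.
have := @xgetPex _ (0 : {malg qmat q[{ffun 'I_n -> nat}]}) [set c | is_Bexpansion u c]%classic (ex_intro _ c uc).
rewrite /Bcoef; move: (xget _ _) => d ud.
rewrite (_ : u = texpand q d); last exact: ud.
by rewrite tcoef_expand.
Qed.

(** * Quantum minors and their symmetry in the upper indices *)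

Section Minors.
Variables (k : fieldType) (n : nat) (q : 'I_n -> 'I_n -> k).
Hypothesis q_neq0 : forall i j : 'I_n, (i < j)%N -> q i j != 0.
Variables (R : algType k) (z : 'I_n -> 'I_n -> R).
Hypothesis zC : forall i j l : 'I_n, (i < j)%N ->
  z j l * z i l = q i j *: (z i l * z j l).
Hypothesis zX : forall i j h l : 'I_n, (i < j)%N -> (h < l)%N ->
  q i j *: (z i h * z j l) - q h l *: (z j l * z i h) =
  z j h * z i l - (q h l * q i j) *: (z i l * z j h).
Local Notation mindex := {ffun 'I_n -> nat}.
Implicit Types (m : mindex) (i j h l : 'I_n) (J S : {set 'I_n}) (s v : seq 'I_n).

(** The weight of the inversions created by placing [j] in front of the elements of [J]. *)
Definition qsgn j J : k := \prod_(i in J | (i < j)%N) (- q i j)^-1.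

Lemma qsgn_neq0 j J : qsgn j J != 0.
Proof.
apply/prodf_neq0 => i /andP[_ ij].
by rewrite invr_eq0 oppr_eq0 q_neq0.
Qed.

Lemma qsgn_setD1 j l J : (j <= l)%N -> qsgn j (J :\ l) = qsgn j J.
Proof.
move=> jl; apply: eq_bigl => i; rewrite !inE; case: eqP => //= ->.
by rewrite ltnNge jl andbF.
Qed.

Lemma qsgnD1 j l J : (l < j)%N -> l \in J ->
  qsgn j J = (- q l j)^-1 * qsgn j (J :\ l).
Proof.
move=> lj lJ; rewrite /qsgn (bigD1 l) ?lJ //=; congr (_ * _).
by apply: eq_bigl => i; rewrite !inE andbC andbA.
Qed.

(* The entries z_j^l with lower index in [J] and upper index in [v], expanded
   along the first upper index. *)
Fixpoint minor v J : R :=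
  if v is l :: v' then \sum_(j in J) qsgn j J *: (z j l * minor v' (J :\ j))
  else (J == set0)%:R.

Lemma minor_cons l v J :
  minor (l :: v) J = \sum_(j in J) qsgn j J *: (z j l * minor v (J :\ j)).
Proof. by []. Qed.

Local Arguments minor : simpl never.

(** A term of the expansion along the first two upper indices, set to 0 outside its range so that
    [sum_pairs_eq0] applies to all pairs. *)
Let minor2 h l v J i j : R :=
  if [&& i \in J, j \in J & j != i] then
    (qsgn i J * qsgn j (J :\ i)) *: (z i h * z j l * minor v (J :\ i :\ j))
  else 0.

Let minorSS h l v J : minor (h :: l :: v) J = \sum_i \sum_j minor2 h l v J i j.
Proof.
rewrite minor_cons big_mkcond; apply: eq_bigr => i _ /=.
have [iJ|iJ] := boolP (i \in J); last first.
  by rewrite big1 // => j _; rewrite /minor2 (negbTE iJ).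
rewrite minor_cons mulr_sumr scaler_sumr big_mkcond; apply: eq_bigr => j _; rewrite /minor2 iJ !inE /=.
by rewrite andbC; case: ifP => // _; rewrite -scalerAr scalerA mulrA.
Qed.

(** The terms for [(i, j)] and [(j, i)] cancel by the relation between entries with equal upper
    index. *)
Lemma minor_same h v J : minor (h :: h :: v) J = 0.
Proof.
rewrite minorSS; apply: sum_pairs_eq0 => [i|i j ij]; rewrite /minor2.
  by rewrite eqxx !andbF.
rewrite [i == j]eq_sym [X in _ + (if X then _ else _)]andbCA.
case: ifP => [/and3P[iJ jJ _]|]; last by rewrite addr0.
rewrite (qsgnD1 ij iJ) (qsgn_setD1 _ (ltnW ij)) (zC h ij) [J :\ j :\ i]setDDl [_ :|: _]setUC -setDDl.
rewrite -scalerAl scalerA -scalerDl (_ : _ + _ = 0) ?scale0r //.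
by field; rewrite oppr_eq0 q_neq0.
Qed.

Lemma minor_swap h l v J : (h < l)%N ->
  minor (l :: h :: v) J = (- q h l)^-1 *: minor (h :: l :: v) J.
Proof.
move=> hl; apply/eqP; rewrite -subr_eq0 -scaleNr invrN opprK; apply/eqP.
rewrite !minorSS scaler_sumr -big_split /=.
under eq_bigr do rewrite scaler_sumr -big_split /=.
apply: sum_pairs_eq0 => [i|i j ij]; rewrite /minor2.
  by rewrite eqxx !andbF scaler0 addr0.
rewrite [i == j]eq_sym [(j \in J) && (_ && _)]andbCA.
case: ifP => [/and3P[iJ jJ _]|]; last by rewrite scaler0 !addr0.
rewrite (qsgnD1 ij iJ) (qsgn_setD1 _ (ltnW ij)) [J :\ j :\ i]setDDl [_ :|: _]setUC -setDDl.
set w := minor _ _; set e := qsgn i J; set f := qsgn j _.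
have p0 := q_neq0 ij; have r0 := q_neq0 hl.
have := zX ij hl; move/(congr1 (fun x => x * w)).
rewrite !mulrBl -!scalerAl => E.
(* With common factors taken out, the terms for [(i, j)] and [(j, i)] add up to the cross relation,
   multiplied on the right by the remaining minor. *)
transitivity ((e * f / (q i j * q h l)) *: ((q h l * q i j) *: (z i l * z j h * w)
   + q i j *: (z i h * z j l * w) - q h l *: (z j l * z i h * w) - z j h * z i l * w)).
  rewrite !scalerBr scalerDr !scalerA -!scaleNr addrA.
  congr (_ *: _ + _ *: _ + _ *: _ + _ *: _); field; rewrite ?oppr_eq0 ?p0 ?r0 //.
by rewrite -[_ + _ - _ *: _]addrA E [_ + (_ - _)]addrC subrK subrr scaler0.
Qed.

(** The index [l] moves right by [minor_swap], gaining one factor for each smaller element of [J'],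
    until it reaches its place or meets its equal. Filtering a sorted list gives an induction that
    [enum J'] does not offer directly. *)
Lemma minor_insert_filter l J' s J : sorted (fun i j => i < j)%N s -> l \in s ->
  minor (l :: filter (mem J') s) J = if l \in J' then 0 else
  (\prod_(i <- s | (i \in J') && (i < l)%N) (- q i l)^-1) *:
     minor (filter (mem (l |: J')) s) J.
Proof.
elim: s J => // x s IH J sx; rewrite inE.
have lts: all (fun j : 'I_n => x < j)%N s.
  by apply: order_path_min sx => a b c; apply: ltn_trans.
have [-> _|lx /= ls] := eqVneq l x.
  rewrite [filter _ (x :: s)]/= [in RHS]/= !inE eqxx /=.
  case: ifP => xJ; first by rewrite minor_same.
  rewrite big_cons ltnn andbF big_seq_cond big1 ?scale1r => [|i]; last first.
    by case/and3P=> is_ _; rewrite ltnNge (ltnW (allP lts _ is_)).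
  congr (minor (_ :: _) _); apply: eq_in_filter => i is_; rewrite !inE.
  by case: eqP => // ix; have := allP lts _ is_; rewrite ix ltnn.
have xl : (x < l)%N by apply: (allP lts).
have {}IH J0 := IH J0 (path_sorted sx) ls.
rewrite big_cons xl andbT !inE eq_sym (negbTE lx) /=.
case: (boolP (x \in J')) => xJ; last by rewrite IH.
rewrite minor_swap // [minor [:: x, l & _] _]minor_cons.
under [in LHS]eq_bigr => j _ do rewrite IH.
case: ifP => lJ; last first.
  rewrite -scalerA; congr (_ *: _); rewrite minor_cons scaler_sumr.
  by apply: eq_bigr => j _; rewrite -scalerAr !scalerA mulrC.
by rewrite big1 ?scaler0 // => j _; rewrite mulr0 scaler0.
Qed.

Lemma minor_insert l J' J : minor (l :: enum J') J =
  if l \in J' then 0 else qsgn l J' *: minor (enum (l |: J')) J.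
Proof.
have enumE (J0 : {set 'I_n}) : filter (mem J0) (index_enum 'I_n) = enum J0.
  by rewrite [index_enum _]unlock.
have := minor_insert_filter J' J (sorted_index_enum_ord n) (mem_index_enum l).
by rewrite !enumE.
Qed.


(** * The chain map on the Koszul complex in multidegree [mu] *)

Variable c : mindex -> mindex -> R.
Hypothesis cS : forall m m' j, qshift q m j *: c (mincr m j) m' =
  \sum_l if (0 < m' l)%N
          then qshift q (mdecr m' [set l]) l *: (c m (mdecr m' [set l]) * z j l)
          else 0.

Lemma qshift_neq0 m j : qshift q m j != 0.
Proof. by apply/prodf_neq0 => l jl; rewrite expf_neq0 ?q_neq0. Qed.

Lemma qshift_mincr_le m j l : (j <= l)%N -> qshift q (mincr m j) l = qshift q m l.
Proof.
move=> jl; apply: eq_bigr => i li; rewrite ffunE; case: eqP => [ij|_]; rewrite ?addn0 //.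
by rewrite ij ltnNge jl in li.
Qed.

Lemma qshift_mincr_gt m j l : (l < j)%N -> qshift q (mincr m j) l = q l j * qshift q m l.
Proof.
move=> lj; rewrite /qshift (bigD1 j) //= [in RHS](bigD1 j) //= ffunE eqxx addn1 exprS -mulrA.
congr (_ * (_ * _)); apply: eq_bigr => i /andP[_ /negbTE ij].
by rewrite ffunE ij addn0.
Qed.

Variable mu : mindex.
Let S : {set 'I_n} := [set l | 0 < mu l]%N.
(** The Koszul differential on [x^(mu - 1_J) e_J]: bringing [e_j] to the front of [e_J] costs
    [qsgn], and absorbing it as [x_j] into the monomial costs [qshift]. *)
Let a J j : k := qshift q (mdecr mu J) j * qsgn j J.

Let mdecrD1 J j : J \subset S -> j \in J -> mdecr mu (J :\ j) = mincr (mdecr mu J) j.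
Proof.
move=> JS jJ; apply/ffunP=> l; rewrite !ffunE !inE.
case: eqP => [->|_] /=; last by rewrite addn0.
have := subsetP JS _ jJ; rewrite inE jJ subn0 => mj.
by rewrite subnK.
Qed.

Let a_anti J j l : J \subset S -> j \in J -> l \in J -> j != l ->
  a J j * a (J :\ j) l + a J l * a (J :\ l) j = 0.
Proof.
wlog jl : j l / (j < l)%N => [W JS jJ lJ jl|JS jJ lJ _].
  have [lt|lt|/val_inj E] := ltngtP j l; first exact: W.
    by rewrite addrC; apply: W; rewrite // eq_sym.
  by rewrite E eqxx in jl.
rewrite /a !mdecrD1 // qshift_mincr_le ?(ltnW jl) // qshift_mincr_gt //.
rewrite (qsgnD1 jl jJ) (qsgn_setD1 _ (ltnW jl)).
by field; rewrite oppr_eq0 q_neq0.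
Qed.

Let M J J' : R := c (mdecr mu J) (mdecr mu J') * minor (enum J') J.

Let chain J J' : J \subset S -> J' \subset S ->
  \sum_(j in J) a J j *: M (J :\ j) J' =
  \sum_(l in S :\: J') a (l |: J') l *: M J (l |: J').
Proof.
move=> JS J'S.
pose m' := mdecr mu J'.
(* The minor with upper indices [l :: enum J'] is read in two ways: expanding it along [l] and using
   [cS] gives the left side, sorting [l] into [J'] gives the right side. *)
transitivity (\sum_l if (0 < m' l)%N then qshift q (mdecr m' [set l]) l *:
    (c (mdecr mu J) (mdecr m' [set l]) * minor (l :: enum J') J) else 0).
  transitivity (\sum_(j in J) \sum_l if (0 < m' l)%N then
      qshift q (mdecr m' [set l]) l *: (c (mdecr mu J) (mdecr m' [set l]) *
        (qsgn j J *: (z j l * minor (enum J') (J :\ j)))) else 0).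
    apply: eq_bigr => j jJ; rewrite /a /M mdecrD1 // mulrC -scalerA scalerAl cS.
    rewrite mulr_suml scaler_sumr; apply: eq_bigr => l _; rewrite -/m'.
    case: ifP => _; last by rewrite mul0r scaler0.
    by rewrite -scalerAl -scalerAr !scalerA mulrC mulrA.
  rewrite exchange_big /=; apply: eq_bigr => l _; case: ifP => _; last by rewrite big1_eq.
  by rewrite -scaler_sumr -mulr_sumr.
rewrite [RHS]big_mkcond; apply: eq_bigr => l _; rewrite minor_insert !inE.
rewrite /m' ffunE; have [lJ|lJ] := boolP (l \in J').
  by rewrite mulr0 scaler0 if_same.
rewrite subn0 /=; case: ifP => // ml.
have -> : mdecr (mdecr mu J') [set l] = mdecr mu (l |: J').
  apply/ffunP=> i; rewrite !ffunE !inE.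
  by case: eqP => [->|_]; rewrite ?(negbTE lJ) ?subn0.
rewrite /a /M -scalerAr scalerA; congr (_ * _ *: _).
by rewrite -(qsgn_setD1 (l |: J') (leqnn l)) setU1K.
Qed.

Lemma koszul_supertrace i : (0 < mu i)%N ->
  \sum_(J : {set 'I_n} | J \subset [set l | 0 < mu l]%N)
    (-1) ^+ #|J| *: (c (mdecr mu J) (mdecr mu J) * minor (enum J) J) = 0.
Proof.
move=> mi; apply: (supertrace_eq0 (i := i) (a := a) (M := M)); first by rewrite inE.
- by move=> J j _ _; rewrite mulf_neq0 ?qshift_neq0 ?qsgn_neq0.
- exact: a_anti.
- exact: chain.
Qed.

End Minors.

(** * Minors as quantum determinants *)

Section MinorDet.
Variables (k : fieldType) (n : nat) (q : 'I_n -> 'I_n -> k).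
Variables (R : algType k) (z : 'I_n -> 'I_n -> R).
Implicit Types (J : {set 'I_n}).

Definition tuple_weight m (w : m.-tuple 'I_n) : k :=
  \prod_(a < m) \prod_(b < m | (a < b)%N && (tnth w b < tnth w a)%N)
     (- q (tnth w b) (tnth w a))^-1.

Lemma tuple_weight_cons m j (w : m.-tuple 'I_n) :
  tuple_weight [tuple of j :: w] =
  (\prod_(i <- w | (i < j)%N) (- q i j)^-1) * tuple_weight w.
Proof.
rewrite /tuple_weight big_ord_recl; congr (_ * _).
  rewrite big_mkcond big_ord_recl /= mul1r big_tuple [RHS]big_mkcond.
  by apply: eq_bigr => b _; rewrite tnth0 tnthS.
apply: eq_bigr => a _; rewrite big_mkcond big_ord_recl /= mul1r [RHS]big_mkcond.
by apply: eq_bigr => b _; rewrite !tnthS.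
Qed.

Lemma uniq_cons_setD1 j (w : seq 'I_n) J :
  uniq (j :: w) && ([set x in j :: w] == J) =
  [&& j \in J, uniq w & [set x in w] == J :\ j].
Proof.
rewrite set_cons /=; apply/idP/idP.
  case/andP=> /andP[jw ->] /eqP <-; rewrite setU11 setU1K ?eqxx //.
  by rewrite inE.
case/and3P=> jJ -> /eqP wE; rewrite wE setD1K // eqxx !andbT.
by have := setD11 j J; rewrite -wE inE => ->.
Qed.

(** All expansions carried out: [w] records the lower indices in the order chosen, and each choice
    contributes the inversions headed by that letter. *)
Lemma minor_tuple m (v : m.-tuple 'I_n) J : minor q z v J =
  \sum_(w : m.-tuple 'I_n | uniq w && ([set x in w] == J))
     tuple_weight w *: \prod_(a < m) z (tnth w a) (tnth v a).
Proof.
elim: m v J => [|m IH] v J.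
  rewrite (tuple0 v) /= big_mkcond (bigD1 [tuple]) //= [X in _ + X]big1 ?addr0 => [|w]; last first.
    by rewrite (tuple0 w) => /eqP.
  by rewrite /tuple_weight !big_ord0 scale1r eq_sym set_nil /=; case: eqP.
case/tupleP: v => l v; rewrite minor_cons.
under eq_bigr do rewrite IH mulr_sumr scaler_sumr.
rewrite pair_big_dep /=.
rewrite [RHS](reindex_onto (fun p : 'I_n * m.-tuple 'I_n => [tuple of p.1 :: p.2])
  (fun t => (thead t, [tuple of behead t]))) /=; last first.
  by move=> t _; case/tupleP: t => i t; apply: val_inj.
apply: eq_big => -[j w] /=.
  rewrite uniq_cons_setD1 theadE xpair_eqE eqxx /=.
  by rewrite (_ : _ == w) ?andbT //; apply/eqP/val_inj.
case/and3P=> jJ uw /eqP wE.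
rewrite big_ord_recl !tnth0 tuple_weight_cons -scalerAr scalerA.
congr ((_ * _) *: (_ * _)); last by apply: eq_bigr => a _; rewrite !tnthS.
rewrite -(qsgn_setD1 q J (leqnn j)) -wE /qsgn.
rewrite -big_filter -[RHS]big_filter; apply: perm_big.
apply: uniq_perm; rewrite ?filter_uniq ?index_enum_uniq //.
by move=> i; rewrite !mem_filter mem_index_enum inE andbT andbC.
Qed.

Lemma ltn_enum_val J (a b : 'I_#|J|) :
  ((enum_val a : 'I_n) < (enum_val b : 'I_n))%N = (a < b)%N.
Proof.
have mono (c d : 'I_#|J|) : (c < d)%N -> ((enum_val c : 'I_n) < (enum_val d : 'I_n))%N.
  move=> cd; rewrite (enum_val_nth (enum_val d)) [X in (_ < nat_of_ord X)%N](enum_val_nth (enum_val d)).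
  apply: (sorted_ltn_nth (leT := fun i j : 'I_n => (i < j)%N)) => //; rewrite ?inE -?cardE //.
  - by move=> x y t; apply: ltn_trans.
  - rewrite /enum_mem; apply: sorted_filter; first by move=> x y t; apply: ltn_trans.
    by have := sorted_index_enum_ord n; rewrite [index_enum _]unlock.
have [/mono//|/mono ba|/val_inj->] := ltngtP a b; last by rewrite ltnn.
by rewrite ltnNge (ltnW ba).
Qed.

(** The repetition-free words listing [J] correspond to the permutations of its positions, with the
    same inversions because [enum_val] is increasing. *)
Lemma minor_enum J : minor q z (enum J) J =
  \sum_(p : 'S_#|J|) inv_weight q p *: \prod_(a < #|J|) z (jth (p a)) (jth a).
Proof.
rewrite (minor_tuple (enum_tuple J)).
pose h (p : 'S_#|J|) : #|J|.-tuple 'I_n := [tuple enum_val (p a) | a < #|J|].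
have h_inj : injective h.
  move=> p p' E; apply/permP=> a; apply: enum_val_inj.
  by have := congr1 (fun t => tnth t a) E; rewrite !tnth_mktuple.
have hP (w : #|J|.-tuple 'I_n) :
    uniq w && ([set x in w] == J) = (w \in h @: [set: 'S_#|J|]).
  apply/idP/imsetP => [/andP[uw /eqP wE]|[p _ ->]].
    have wJ a : tnth w a \in J.
      by move/setP/(_ (tnth w a)): wE; rewrite inE mem_tnth.
    pose f a := enum_rank_in (wJ a) (tnth w a).
    have fE a : enum_val (f a) = tnth w a by apply: enum_rankK_in.
    have f_inj : injective f.
      move=> a b fab; have := congr1 (fun c => enum_val c) fab.
      by rewrite !fE; apply/tuple_uniqP.
    exists (perm f_inj); rewrite ?inE //; apply: eq_from_tnth => a.
    by rewrite tnth_mktuple permE fE.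
  apply/andP; split.
    by rewrite map_inj_uniq ?enum_uniq // => a b /enum_val_inj/perm_inj.
  apply/eqP/setP=> x; rewrite inE; apply/mapP/idP => [[a _ ->]|xJ]; first exact: enum_valP.
  exists ((p^-1)%g (enum_rank_in xJ x)); rewrite ?mem_enum // permKV.
  by rewrite enum_rankK_in.
rewrite (eq_bigl _ _ hP) big_imset => [|p p' _ _]; last exact: h_inj.
apply: eq_big => [p|p _]; first by rewrite inE.
congr (_ *: _); last first.
  apply: eq_bigr => a _; rewrite tnth_mktuple; congr (z _ _).
  by rewrite (tnth_nth (enum_default a)).
apply: eq_bigr => a _; apply: eq_big => [b|b _]; rewrite !tnth_mktuple //.
by rewrite ltn_enum_val.
Qed.

End MinorDet.

(** * Commutation of the [X_i], and the product of the two series *)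

(** Once [x_l x_h] is rewritten as a multiple of [x_h x_l], the terms for [(h, l)] and [(l, h)]
    combine into the cross relation; the diagonal terms vanish by the relation with equal upper
    indices. *)
Lemma tens_qcomm (k : fieldType) n (q : 'I_n -> 'I_n -> k) (B A : algType k)
    (z : 'I_n -> 'I_n -> B) (x : 'I_n -> A) (i j : 'I_n) :
  (forall h, z j h * z i h = q i j *: (z i h * z j h)) ->
  (forall h l : 'I_n, (h < l)%N ->
    q i j *: (z i h * z j l) - q h l *: (z j l * z i h) =
    z j h * z i l - (q h l * q i j) *: (z i l * z j h)) ->
  (forall h l : 'I_n, (h < l)%N -> x l * x h = q h l *: (x h * x l)) ->
  (\sum_h tens (z j h) (x h)) * (\sum_l tens (z i l) (x l)) =
  q i j *: ((\sum_h tens (z i h) (x h)) * (\sum_l tens (z j l) (x l))) :> tensor B A.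
Proof.
move=> zC zX xC; apply/eqP; rewrite -subr_eq0; apply/eqP.
transitivity (\sum_h \sum_l
    (tens (z j h * z i l - q i j *: (z i h * z j l)) (x h * x l) : tensor B A)).
  rewrite !big_distrlr /= scaler_sumr -sumrB; apply: eq_bigr => h _.
  rewrite scaler_sumr -sumrB; apply: eq_bigr => l _.
  by rewrite !tensM -scaleN1r tensDl -tensZl -tensZl scaleN1r.
have tens0 a : tens 0 a = 0 :> tensor B A.
  by have := tensZl 0 (0 : B) a; rewrite !scale0r.
apply: sum_pairs_eq0 => [h|h l hl]; first by rewrite zC subrr tens0.
rewrite (xC _ _ hl) tensZr -tensZl -tensDl -[RHS](tens0 (x h * x l)); congr tens.
rewrite scalerBr scalerA addrACA [X in _ + X]addrC -addrACA -(zX _ _ hl).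
by rewrite -opprB addNr.
Qed.

(** Regroups a Cauchy product by multidegree: pairs of a multi-index and a subset [J] of total
    degree [l] become, after adding [1_J], pairs in which [J] lies in the support. *)
Lemma sum_multiindex_subset (R : pzRingType) n (G : {ffun 'I_n -> nat} -> R)
    (D : {set 'I_n} -> R) l :
  \sum_(i < l.+1)
    (\sum_(m : {ffun 'I_n -> 'I_i.+1} | (\sum_(a < n) m a == i)%N)
       G [ffun a => m a : nat]) * (\sum_(J : {set 'I_n} | (#|J| == l - i)%N) D J) =
  \sum_(m : {ffun 'I_n -> 'I_l.+1} | (\sum_(a < n) m a == l)%N)
     \sum_(J : {set 'I_n} | J \subset [set a | 0 < m a]%N)
       G (mdecr [ffun a => m a : nat] J) * D J.
Proof.
have le_sum N (m : {ffun 'I_n -> 'I_N}) a : (m a <= \sum_(a < n) m a)%N.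
  by rewrite (bigD1 a) //= leq_addr.
have G_widen (i : 'I_l.+1) :
  \sum_(m : {ffun 'I_n -> 'I_i.+1} | (\sum_(a < n) m a == i)%N) G [ffun a => m a : nat] =
  \sum_(m : {ffun 'I_n -> 'I_l.+1} | (\sum_(a < n) m a == i)%N) G [ffun a => m a : nat].
  rewrite [RHS](reindex_onto (fun m : {ffun 'I_n -> 'I_i.+1} => [ffun a => inord (m a) : 'I_l.+1])
     (fun m : {ffun 'I_n -> 'I_l.+1} => [ffun a => inord (m a) : 'I_i.+1])) /=; last first.
    move=> m /eqP mi; apply/ffunP=> a; rewrite !ffunE; apply: val_inj => /=.
    by rewrite !inordK // ltnS (leq_trans (le_sum _ m a)) // mi.
  have vE (m : {ffun 'I_n -> 'I_i.+1}) a : (inord (m a) : 'I_l.+1) = m a :> nat.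
    by rewrite inordK // (leq_trans (ltn_ord _)).
  apply: eq_big => [m|m _]; last by congr G; apply/ffunP=> a; rewrite !ffunE vE.
  under [in RHS]eq_bigr do rewrite ffunE vE.
  rewrite (_ : _ == m) ?andbT //; apply/eqP/ffunP=> a; rewrite !ffunE.
  by apply: val_inj; rewrite /= vE inordK.
pose P (m : {ffun 'I_n -> 'I_l.+1}) (J : {set 'I_n}) := (\sum_(a < n) m a + #|J| == l)%N.
transitivity (\sum_(m : {ffun 'I_n -> 'I_l.+1}) \sum_(J | P m J) G [ffun a => m a : nat] * D J).
  rewrite [RHS](bigID (fun m : {ffun 'I_n -> 'I_l.+1} => \sum_(a < n) m a <= l)%N) /=.
  rewrite [X in _ = _ + X]big1 ?addr0 => [|m ml]; last first.
    by rewrite big_pred0 // => J; apply: contraNF ml => /eqP mJ; rewrite (leq_trans _ (eq_leq mJ)) ?leq_addr.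
  rewrite [RHS](partition_big (fun m : {ffun 'I_n -> 'I_l.+1} => inord (\sum_(a < n) m a) : 'I_l.+1) xpredT) //=.
  apply: eq_bigr => i _; rewrite G_widen big_distrlr /=; apply: eq_big => [m|m /eqP mi].
    apply/eqP/andP => [mi|[ml /eqP <-]]; last by rewrite inordK.
    by rewrite mi -ltnS ltn_ord; split=> //; apply/eqP/val_inj; rewrite /= inordK.
  apply: eq_bigl => J; rewrite /P mi; have il : (i <= l)%N by rewrite -ltnS.
  by rewrite -(eqn_add2l i) subnKC.
rewrite !pair_big_dep /=.
rewrite [LHS](reindex_onto
  (fun p : {ffun 'I_n -> 'I_l.+1} * {set 'I_n} => ([ffun a => inord (p.1 a - (a \in p.2)) : 'I_l.+1], p.2))
  (fun p => ([ffun a => inord (p.1 a + (a \in p.2)) : 'I_l.+1], p.2))) /=; last first.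
  case=> m J; rewrite /P /= => /eqP mJ; congr (_, _); apply/ffunP=> a; rewrite !ffunE.
  have : (m a + (a \in J) < l.+1)%N.
    rewrite ltnS (leq_trans _ (eq_leq mJ)) // leq_add //; case: (boolP (a \in J)) => // aJ.
    by rewrite (cardD1 a) aJ.
  by move=> lt; apply: val_inj; rewrite /= !inordK // addnK.
have vE (m : {ffun 'I_n -> 'I_l.+1}) a (b : bool) : (inord (m a - b) : 'I_l.+1) = (m a - b)%N :> nat.
  by rewrite inordK // (leq_ltn_trans (leq_subr _ _)).
apply: eq_big => [[m J]|[m J] _] /=; last first.
  by congr (G _ * _); apply/ffunP=> a; rewrite !ffunE vE.
rewrite /P xpair_eqE eqxx andbT.
have JE : (#|J| = \sum_(a < n) (a \in J))%N by rewrite -sum1_card big_mkcond; apply: eq_bigr => a _; case: (a \in J).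
have [JS|JS] := boolP (J \subset _); last first.
  rewrite andbF; apply/negbTE; apply: contra JS => /andP[/eqP sl /eqP /ffunP E].
  apply/subsetP=> a aJ; rewrite inE -ltnS.
  have := congr1 val (E a); rewrite /= !ffunE vE aJ.
  (* If [m a] were 0, subtracting and adding back would give 1. The value 1 fits in ['I_l.+1], since
     [a] in [J] forces [l] to be positive. *)
  case: (nat_of_ord (m a)) => //=; rewrite inordK // ltnS.
  by rewrite (leq_trans _ (eq_leq sl)) // (cardD1 a) aJ addnCA.
have mS a : (m a - (a \in J) + (a \in J))%N = m a.
  by rewrite subnK //; case: (boolP (a \in J)) => // /(subsetP JS); rewrite inE.
rewrite andbT JE -big_split /= (eq_bigr (fun a => nat_of_ord (m a))) => [|a _]; last first.
  by rewrite ffunE vE mS.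
rewrite (_ : _ == m) ?andbT //; apply/eqP/ffunP=> a; rewrite !ffunE vE mS.
by apply: val_inj; rewrite /= inordK.
Qed.

Lemma master_sum (k : fieldType) n (q : 'I_n -> 'I_n -> k) (B : algType k)
    (z : 'I_n -> 'I_n -> B) (c : {ffun 'I_n -> nat} -> {ffun 'I_n -> nat} -> B) l :
  (forall i j : 'I_n, (i < j)%N -> q i j != 0) ->
  (forall i j h : 'I_n, (i < j)%N -> z j h * z i h = q i j *: (z i h * z j h)) ->
  (forall i j h l : 'I_n, (i < j)%N -> (h < l)%N ->
    q i j *: (z i h * z j l) - q h l *: (z j l * z i h) =
    z j h * z i l - (q h l * q i j) *: (z i l * z j h)) ->
  (forall m m' j, qshift q m j *: c (mincr m j) m' =
    \sum_h if (0 < m' h)%N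
           then qshift q (mdecr m' [set h]) h *: (c m (mdecr m' [set h]) * z j h)
           else 0) ->
  c [ffun=> 0%N] [ffun=> 0%N] = 1 ->
  \sum_(i < l.+1)
    (\sum_(m : {ffun 'I_n -> 'I_i.+1} | (\sum_(a < n) m a == i)%N)
       c [ffun a => m a : nat] [ffun a => m a : nat]) *
    (\sum_(J : {set 'I_n} | (#|J| == l - i)%N)
       (-1) ^+ #|J| *: minor q z (enum J) J) = (l == 0)%N%:R.
Proof.
move=> q0 zC zX cS c0.
rewrite (sum_multiindex_subset (fun m => c m m)
  (fun J => (-1) ^+ #|J| *: minor q z (enum J) J)).
have m0 (m : {ffun 'I_n -> 'I_l.+1}) : \sum_(J : {set 'I_n} | J \subset [set a | 0 < m a]%N)
    c (mdecr [ffun a => m a : nat] J) (mdecr [ffun a => m a : nat] J) *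
      ((-1) ^+ #|J| *: minor q z (enum J) J) = (\sum_(a < n) m a == 0)%N%:R.
  (* Multidegree 0 is the exception: only [J = set0] is left, and it contributes [c 0 0 = 1]. *)
  set mu := [ffun a => m a : nat]; have [m0|] := boolP (\sum_(a < n) m a == 0)%N.
    have muE : mu = [ffun=> 0%N].
      by apply/ffunP=> a; rewrite !ffunE; move: m0; rewrite sum_nat_eq0 => /forallP/(_ a)/eqP.
    rewrite (big_pred1 set0) => [|J]; last first.
      rewrite (_ : [set a | _] = set0) ?subset0 //; apply/setP=> a.
      by rewrite !inE; move/ffunP/(_ a): muE; rewrite !ffunE => ->.
    rewrite cards0 expr0 scale1r enum_set0 /= eqxx mulr1 -c0 muE.
    by congr c; apply/ffunP=> a; rewrite !ffunE.
  rewrite sum_nat_eq0 negb_forall => /existsP[i /=]; rewrite -lt0n => mi.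
  have mui : (0 < mu i)%N by rewrite ffunE.
  have := koszul_supertrace q0 zC zX cS mui.
  rewrite (_ : [set a | 0 < mu a]%N = [set a | 0 < m a]%N) => [E|]; last first.
    by apply/setP=> a; rewrite !inE ffunE.
  by rewrite -[RHS]E; apply: eq_bigr => J _; rewrite scalerAr.
under eq_bigr do rewrite m0.
have [->|l0] := eqVneq l 0%N.
  rewrite (big_pred1 [ffun=> ord0]) => [|m].
    by rewrite big1 // => a _; rewrite ffunE.
  apply/idP/eqP => [_|->]; first by apply/ffunP=> a; rewrite ffunE ord1.
  by rewrite big1 // => a _; rewrite ffunE.
by rewrite big1 // => m /eqP ->; rewrite (negbTE l0).
Qed.

Lemma prod_expr0 (R : pzRingType) n (y : 'I_n -> R) :
  \prod_(i < n) y i ^+ [ffun=> 0%N : nat] i = 1.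
Proof. by rewrite big1 // => i _; rewrite ffunE expr0. Qed.

(** * The coefficients of the [X^m] in the quantum matrix algebra, and the theorem *)

Section QuantumMatrixCoefficients.
Variables (k : fieldType) (n : nat) (q : 'I_n -> 'I_n -> k).
Local Notation mindex := {ffun 'I_n -> nat}.

Lemma qzC (i j l : 'I_n) : (i < j)%N ->
  qz q j l * qz q i l = q i j *: (qz q i l * qz q j l).
Proof.
move=> ij; rewrite /qz /pres_gen -!pres_piM -pres_piZ.
exact/pres_piP/rel_ideal_base/Qmat_rel_same.
Qed.

Lemma qzX (i j h l : 'I_n) : (i < j)%N -> (h < l)%N ->
  q i j *: (qz q i h * qz q j l) - q h l *: (qz q j l * qz q i h) =
  qz q j h * qz q i l - (q h l * q i j) *: (qz q i l * qz q j h).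
Proof.
move=> ij hl.
rewrite /qz /pres_gen -!pres_piM -!pres_piZ -2!pres_piB.
exact/pres_piP/rel_ideal_base/Qmat_rel_cross.
Qed.

Lemma qXC (i j : 'I_n) : (i < j)%N -> qX q j * qX q i = q i j *: (qX q i * qX q j).
Proof.
move=> ij; apply: (@tens_qcomm k n q (qmat q) (qspace q) (qz q) (qx q)) => [h|h l hl|h l hl].
- exact: qzC.
- exact: qzX.
- exact: qxC.
Qed.

Lemma qX_mon_mulr (m : mindex) j :
  qX_mon q m * qX q j = qshift q m j *: qX_mon q (mincr m j).
Proof.
pose T := tensor (qmat q) (qspace q).
apply: (@qmon_mulr k n q T (fun a (x : T) => a *: x)) => [x|a b x|a x y|a x y|].
- exact: scale1r.
- exact: scalerA.
- by rewrite [RHS]pres_scalerAl.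
- by rewrite [RHS]pres_scalerAr.
- exact: qXC.
Qed.

(** Compare the coefficients of [x^m'] in [X^m X_j], once straightened to a multiple of a monomial
    in the [X_i], once with [X_j] expanded in the [x_h]. *)
Lemma tcoef_qX_mon (m m' : mindex) j :
  qshift q m j *: tcoef q (qmat q) m' (qX_mon q (mincr m j)) =
  \sum_h if (0 < m' h)%N
         then qshift q (mdecr m' [set h]) h *:
           (tcoef q (qmat q) (mdecr m' [set h]) (qX_mon q m) * qz q j h)
         else 0.
Proof.
transitivity (tcoef q (qmat q) m' (qshift q m j *: qX_mon q (mincr m j))).
  exact/esym/linearZ.
rewrite -(qX_mon_mulr m j).
exact: (tcoef_mulr_sum (B := qmat q)).
Qed.

End QuantumMatrixCoefficients.

Theorem theorem3 (k : fieldType) (n : nat) (n_gt0 : (0 < n)%N)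
  (q : 'I_n -> 'I_n -> k)
  (q_neq0 : forall i j : 'I_n, (i < j)%N -> q i j != 0) :
  Bos q * Ferm q = 1 :> powser (qmat q).
Proof.
apply/boolp.funext=> l.
have c0 : tcoef q (qmat q) [ffun=> 0%N] (qX_mon q [ffun=> 0%N]) = 1.
  rewrite (_ : qX_mon q _ = tens 1 (qx_mon q [ffun=> 0%N])).
    by rewrite tcoef_tens qcoef_mon eqxx scale1r.
  by rewrite /qX_mon /qx_mon !prod_expr0 tens1.
have := @master_sum k n q (qmat q) (qz q)
  (fun m m' => tcoef q (qmat q) m' (qX_mon q m)) l q_neq0 (@qzC k n q) (@qzX k n q)
  (@tcoef_qX_mon k n q) c0.
move=> E; rewrite -[RHS]E.
apply: (@eq_bigr (qmat q)) => i _; congr (_ * _).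
  by apply: eq_bigr => m _; apply: Bcoef_tcoef.
apply: eq_bigr => J /eqP Jl.
(* Reducing both signs to parities identifies multiplication by a sign of [B] with scaling by a sign
   of [k]. *)
rewrite -Jl /qdet minor_enum -signr_odd -[in RHS]signr_odd mulr_sign.
by rewrite scaler_sign.
Qed.
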